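(* Let $(X,d)$ be an $n$-point metric space and let $h$ be a chaining functional of log-concave type with $|h'(1)|=1$ (left derivative). For any probability measure $\nu$ on $X$, there exists a nonempty set $S\subseteq\{x\in X:\nu(x)>0\}$ such that $$\int_X\int_0^\infty h(\nu(B(x,r)))\,dr\,d\nu(x)\;\le\;\min_{x\in S}\int_0^\infty h(\nu_S(B(x,r)))\,dr\;+\;\mathbf D(X).$$ Furthermore, $S$ can be computed using at most $O(n^3)$ arithmetic operations and evaluations of $h$.
   Context: $B(x,r)=\{y\in X: d(x,y)\le r\}$ and $\mathbf D(X)=\max_{u,v\in X}d(u,v)$. For $S\subseteq X$ with $\nu(S)>0$, $\nu_S$ is the conditional probability measure $\nu_S(A)=\nu(A\cap S)/\nu(S)$ for $A\subseteq X$. Chaining functional: let $f:[0,\infty)\to[0,\infty)$ be a continuous, non-increasing probability density on $[0,\infty)$ and let $F(s)=\int_s^\infty f(t)\,dt$. The chaining functional induced by $f$ is $h(p)=F^{-1}(p)$ for $p\in(0,1]$ (so $h(1)=0$ and $h$ is strictly decreasing and convex). It is of log-concave type if $f$ is log-concave. The normalization $|h'(1)|=1$ is equivalent to $f(0)=1$. *)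

(* Defs.v *)
From HB Require Import structures.
From mathcomp Require Import all_boot all_order all_algebra.
From mathcomp Require Import all_classical all_reals all_analysis.

Set Implicit Arguments.
Unset Strict Implicit.
Unset Printing Implicit Defensive.

Import Order.TTheory GRing.Theory Num.Theory.
Import numFieldNormedType.Exports.

Local Open Scope classical_set_scope.
Local Open Scope ring_scope.

#[short(type="finMetricType")]
HB.structure Definition FinMetric (K : numDomainType) :=
  {M of Metric K M & Finite M}.

Section FiniteMetricSpace.
Context {R : realType} {X : finMetricType R}.
Implicit Types (nu : X -> R) (A S : {set X}).

(* The library's [ball] is open and its [closed_ball] is the closure of an
   open ball, so neither is the ball used here. *)
Definition cball (x : X) (r : R) : {set X} := [set y : X | mdist x y <= r]%SET.

Definition diam : R := \big[Num.max/0]_(u : X) \big[Num.max/0]_(v : X) mdist u v.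

(* A probability measure on X is given by its point masses. *)
Definition is_prob nu : Prop :=
  (forall x, 0 <= nu x) /\ \sum_(x : X) nu x = 1.

Definition meas nu A : R := \sum_(x in A) nu x.

Definition cond nu S A : R := meas nu (A :&: S)%SET / meas nu S.

(* [chain_int h m x] is the integral over r in [0, +oo[ of h (m (B(x, r))).
   It is extended-real valued because m (B(x, r)) may be 0 at a point x of
   measure zero, where h carries no meaning; such points have weight 0 in
   [\sum_x (nu x)%:E * _], and 0 * y = 0 for every y in \bar R. *)
Definition chain_int (h : R -> R) (m : {set X} -> R) (x : X) : \bar R :=
  (\int[lebesgue_measure]_(r in `[0%R, +oo[) (h (m (cball x r)))%:E)%E.

End FiniteMetricSpace.

Section ChainingFunctional.
Context {R : realType}.
Implicit Types f h : R -> R.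

(* f : [0, +oo[ -> [0, +oo[ is represented by a total function whose values
   on negative reals are irrelevant. *)
Definition monotone_density f : Prop :=
  [/\ {within `[0, +oo[, continuous f},
      forall t, 0 <= t -> 0 <= f t,
      forall s t, 0 <= s -> s <= t -> f t <= f s &
      (\int[lebesgue_measure]_(t in `[0%R, +oo[) (f t)%:E = 1)%E].

Definition tail f (s : R) : \bar R :=
  (\int[lebesgue_measure]_(t in `[s, +oo[) (f t)%:E)%E.

(* h = F^-1 on ]0, 1], where F = tail f on [0, +oo[; h is unconstrained
   elsewhere. *)
Definition chaining_functional f h : Prop :=
  forall p s : R, 0 < p -> p <= 1 -> 0 <= s -> (h p = s <-> tail f s = p%:E).

Definition log_concave f : Prop :=
  forall x y t : R, 0 <= x -> 0 <= y -> 0 <= t -> t <= 1 ->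
    f x `^ t * f y `^ (1 - t) <= f (t * x + (1 - t) * y).

Definition left_derivative h (x l : R) : Prop :=
  (h t - h x) / (t - x) @[t --> x^'-] --> l.

End ChainingFunctional.

(******************************************************************************)
(* A real RAM, given as a structured language with arrays of natural numbers  *)
(* and arrays of reals, both initially 0. Programs are finite objects that    *)
(* do not depend on R, on the number n of points, or on h: reals enter only   *)
(* through numerals, the distances and point masses of the input, and calls   *)
(* to the oracle for h. A node of an expression costs one unit each time it   *)
(* is evaluated, and so does each executed command and loop iteration, so     *)
(* that arithmetic operations, evaluations of h, comparisons, input reads,    *)
(* memory accesses and index manipulations are all counted.                   *)
(******************************************************************************)

Inductive nexp : Type :=
| NLit of nat
| NSize                      (* the number of points *)
| NCell of nat & nexp        (* array name, index *)
| NAdd of nexp & nexp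
| NSub of nexp & nexp.       (* truncated *)

Inductive rexp : Type :=
| RLit of nat
| RCell of nat & nexp        (* array name, index *)
| RDist of nexp & nexp       (* distance between two labelled points *)
| RMass of nexp              (* mass of a labelled point *)
| RAdd of rexp & rexp
| RSub of rexp & rexp
| RMul of rexp & rexp
| RDiv of rexp & rexp        (* x / 0 = 0 *)
| ROracle of rexp.           (* evaluation of h *)

Inductive bexp : Type :=
| BNle of nexp & nexp
| BRle of rexp & rexp
| BNot of bexp
| BAnd of bexp & bexp.

Inductive cmd : Type :=
| Skip
| NSet of nat & nexp & nexp  (* array name, index, value *)
| RSet of nat & nexp & rexp  (* array name, index, value *)
| Emit of nexp               (* adds a label to the output set *)
| Seq of cmd & cmd
| If of bexp & cmd & cmd
| For of nat & nexp & cmd.   (* cell 0 of the named array runs through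
                                0, ..., m - 1, where m is evaluated once *)

Record input (R : Type) := Input {
  in_size : nat;
  in_dist : nat -> nat -> R;
  in_mass : nat -> R;
  in_oracle : R -> R }.

Record state (R : Type) := State {
  nmem : nat -> nat -> nat;
  rmem : nat -> nat -> R;
  output : seq nat;
  clock : nat }.

Fixpoint ncost (e : nexp) : nat :=
  match e with
  | NLit _ | NSize => 1
  | NCell _ i => (ncost i).+1
  | NAdd e1 e2 | NSub e1 e2 => (ncost e1 + ncost e2).+1
  end.

Fixpoint rcost (e : rexp) : nat :=
  match e with
  | RLit _ => 1
  | RCell _ i | RMass i => (ncost i).+1
  | RDist i j => (ncost i + ncost j).+1
  | RAdd e1 e2 | RSub e1 e2 | RMul e1 e2 | RDiv e1 e2 =>
      (rcost e1 + rcost e2).+1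
  | ROracle e1 => (rcost e1).+1
  end.

Fixpoint bcost (b : bexp) : nat :=
  match b with
  | BNle e1 e2 => (ncost e1 + ncost e2).+1
  | BRle e1 e2 => (rcost e1 + rcost e2).+1
  | BNot b1 => (bcost b1).+1
  | BAnd b1 b2 => (bcost b1 + bcost b2).+1
  end.

Section Semantics.
Context {R : realType}.
Variable inp : input R.
Implicit Type s : state R.

Fixpoint neval s (e : nexp) : nat :=
  match e with
  | NLit k => k
  | NSize => in_size inp
  | NCell a i => nmem s a (neval s i)
  | NAdd e1 e2 => (neval s e1 + neval s e2)%N
  | NSub e1 e2 => (neval s e1 - neval s e2)%N
  end.

Fixpoint reval s (e : rexp) : R :=
  match e with
  | RLit k => k%:R
  | RCell a i => rmem s a (neval s i)
  | RDist i j => in_dist inp (neval s i) (neval s j)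
  | RMass i => in_mass inp (neval s i)
  | RAdd e1 e2 => reval s e1 + reval s e2
  | RSub e1 e2 => reval s e1 - reval s e2
  | RMul e1 e2 => reval s e1 * reval s e2
  | RDiv e1 e2 => reval s e1 / reval s e2
  | ROracle e1 => in_oracle inp (reval s e1)
  end.

Fixpoint beval s (b : bexp) : bool :=
  match b with
  | BNle e1 e2 => (neval s e1 <= neval s e2)%N
  | BRle e1 e2 => reval s e1 <= reval s e2
  | BNot b1 => ~~ beval s b1
  | BAnd b1 b2 => beval s b1 && beval s b2
  end.

Definition upd (T : Type) (m : nat -> nat -> T) (a i : nat) (v : T) :
    nat -> nat -> T :=
  fun b j => if (b == a) && (j == i) then v else m b j.

Definition tick (k : nat) s : state R :=
  State (nmem s) (rmem s) (output s) (clock s + k).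

Definition nset (a i v : nat) s : state R :=
  State (upd (nmem s) a i v) (rmem s) (output s) (clock s).

Definition rset (a i : nat) (v : R) s : state R :=
  State (nmem s) (upd (rmem s) a i v) (output s) (clock s).

Definition emit (i : nat) s : state R :=
  State (nmem s) (rmem s) (i :: output s) (clock s).

Fixpoint run (c : cmd) s : state R :=
  match c with
  | Skip => tick 1 s
  | NSet a i e =>
      tick (ncost i + ncost e).+1 (nset a (neval s i) (neval s e) s)
  | RSet a i e =>
      tick (ncost i + rcost e).+1 (rset a (neval s i) (reval s e) s)
  | Emit i => tick (ncost i).+1 (emit (neval s i) s)
  | Seq c1 c2 => run c2 (run c1 (tick 1 s))
  | If b c1 c2 =>
      let s' := tick (bcost b).+1 s in
      if beval s b then run c1 s' else run c2 s'
  | For a e c1 =>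
      iteri (neval s e) (fun i s' => run c1 (tick 1 (nset a 0 i s')))
            (tick (ncost e).+1 s)
  end.

Definition init : state R :=
  State (fun _ _ => 0%N) (fun _ _ => 0) [::] 0.

End Semantics.

Section Problem.
Context {R : realType} {X : finMetricType R} {n : nat}.

(* The points of X are presented to a program through a labelling e by
   0, ..., n - 1; reads at labels that are out of range return 0. *)
Definition problem_input (e : 'I_n -> X) (nu : X -> R) (h : R -> R) : input R :=
  Input n
    (fun i j => if (insub i, insub j) is (Some i', Some j')
                then mdist (e i') (e j') else 0)
    (fun i => if insub i is Some i' then nu (e i') else 0)
    h.

Definition output_set (e : 'I_n -> X) (s : state R) : {set X} :=
  [set e i | i : 'I_n & (i : nat) \in output s]%SET.

Definition computes (P : cmd) (e : 'I_n -> X) (nu : X -> R) (h : R -> R)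
    (S : {set X}) (t : nat) : Prop :=
  let s := run (problem_input e nu h) P init in
  output_set e s = S /\ (clock s <= t)%N.

End Problem.

(* Main.v *)
Require Import Defs.
From HB Require Import structures.
From mathcomp Require Import all_boot all_order all_algebra.
From mathcomp Require Import all_classical all_reals all_analysis.
From mathcomp Require Import measurable_realfun zify ring lra.

Set Implicit Arguments.
Unset Strict Implicit.
Unset Printing Implicit Defensive.

Import Order.TTheory GRing.Theory Num.Theory.
Import numFieldNormedType.Exports.

Local Open Scope classical_set_scope.
Local Open Scope ring_scope.

(** Write I(m, x) for the chaining integral of h at x against the measure m, D
for the diameter and nu_S for nu conditioned on S.

The set S is found greedily.  Let S_0 be the support of nu and obtain S_(k+1)
from S_k by deleting a point x_k at which I(nu_(S_k), .) is least.  The set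
returned is the S_k whose minimum is largest; call that minimum M.  Two facts
about h make this work.

- If F is the tail of a log-concave density then F(s + t) <= F(s) F(t)
  ([tail_submul]), so that h(p q) <= h(p) + h(q) ([chaining_submul]).  A ball
  satisfies nu(B) >= nu(S) nu_S(B), and balls of radius at least D have full
  measure, where h vanishes; hence I(nu, x) <= I(nu_S, x) + D h(nu(S)) for x in
  S ([chain_sum_supp_le]).  Taking S = S_k and x = x_k gives
  I(nu, x_k) <= M + D h(nu(S_k)).

- Subadditivity gives h(p) <= j h(p^(1/j)) for every j, and |h'(1)| = 1
  evaluates the right-hand side as j grows: h(p) <= - ln p
  ([chaining_le_ln]).

Averaging the first fact over the deleted points, it remains to see that the
sum of nu(x_k) (- ln nu(S_k)) is at most 1.  It is a lower Riemann sum for the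
integral of - ln over ]0, 1]; the antiderivative p - p ln p turns this into one
telescoping inequality per step ([entropy_step]).  The invariant [greedy_inv]
is the partial form of the resulting bound.

For the running time, r |-> B(x, r) is a step function, so I(nu_S, x) is a sum
over the points y of h(nu_S(B(x, d(x, y)))) times the gap between d(x, y) and
the next distance from x ([integral_level]).  Gaps depend only on the metric
and are tabulated once, in cubic time.  The masses nu(S inter B(x, d(x, y)))
are tabulated too, and deleting a point of S updates the table in quadratic
time.  A round is thus quadratic, and there are n rounds.  Ties between
distances are broken by labels ([later]), so that all but one of several
equidistant points get gap 0.

The program is verified separately from the inequality.  Its cost is bounded
statically from its syntax ([clock_run], [cost_bound_poly]); its effect is
described by [greedy_program_sound], which reduces every statement about the
output to an invariant of the abstract greedy procedure. *)

(** * Translation invariance, and log-concave densities *)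

Section Translation.
Context {R : realType}.
Local Notation mu := (@lebesgue_measure R).

Lemma shift_preimage_itvbndbnd (c a b : R) (ba bb : bool) :
  (+%R c : R -> R) @^-1` [set` Interval (BSide ba (c + a)) (BSide bb (c + b))] =
  [set` Interval (BSide ba a) (BSide bb b)].
Proof.
apply/seteqP; split=> x /=; rewrite !in_itv /=; case: ba; case: bb;
  by rewrite /= ?lerD2l ?ltrD2l.
Qed.

(** A measure that agrees with Lebesgue measure on the half-open intervals
agrees with it on all Borel sets, and translation preserves the lengths of
intervals. *)
Lemma lebesgue_measure_shift (c : R) (A : set R) : measurable A ->
  pushforward mu (+%R c : measurableTypeR R -> measurableTypeR R) A = mu A.
Proof.
move=> mA; apply/esym/lebesgue_measure_unique => //=.
  by apply: measurable_funD.
move=> _ _ [[a b]] _ <-.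
rewrite /pushforward /=.
have := shift_preimage_itvbndbnd c (a - c) (b - c) false false.
rewrite !subrKC => ->; rewrite !lebesgue_measure_itv/= !lte_fin.
by rewrite ltrD2r -!EFinB; congr (if _ then _%:E else _); ring.
Qed.

Lemma ge0_integral_shift (f : R -> \bar R) (c a : R) :
  measurable_fun [set: R] f -> (forall r, 0 <= f r)%E ->
  (\int[mu]_(r in `[(c + a)%R, +oo[) f r = \int[mu]_(r in `[a, +oo[) f (c + r)%R)%E.
Proof.
move=> mf f0; rewrite (_ : `[a, +oo[%classic =
    (+%R c : measurableTypeR R -> measurableTypeR R) @^-1` `[(c + a)%R, +oo[); last first.
  by apply/seteqP; split=> x /=; rewrite !in_itv /= !andbT lerD2l.
have mc : measurable_fun setT (+%R c : measurableTypeR R -> measurableTypeR R).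
  by apply: measurable_funD.
rewrite -(@ge0_integral_pushforward _ _ (measurableTypeR R) (measurableTypeR R)
  R _ mc mu `[(c + a)%R, +oo[ f)//=; last exact: measurable_funS mf.
  by apply: eq_measure_integral => //= A mA AS; exact/esym/lebesgue_measure_shift.
Qed.
End Translation.

(** Both v and s + u lie between u and s + v, in complementary proportions: if
v = l (s + v) + (1 - l) u then s + u = (1 - l) (s + v) + l u.  Multiplying the
two instances of log-concavity cancels the exponents. *)
Lemma log_concave_exchange (R : realType) (f : R -> R) (s u v : R) :
  (forall t, 0 <= t -> 0 <= f t) -> log_concave f ->
  0 <= s -> 0 <= u -> u <= v -> f (s + v) * f u <= f v * f (s + u).
Proof.
move=> f0 fl s0 u0 uv; have v0 := le_trans u0 uv.
have sv0 : 0 <= s + v by rewrite addr_ge0.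
have [fu0|fu0] := eqVneq (f u) 0.
  by rewrite fu0 mulr0 mulr_ge0 ?f0 // addr_ge0.
have [fsv|fsv] := eqVneq (f (s + v)) 0.
  by rewrite fsv mul0r mulr_ge0 ?f0 // addr_ge0.
have [w0|w0] := eqVneq (s + (v - u)) 0.
  have -> : v = u by lra.
  by rewrite mulrC.
have wp : 0 < s + (v - u) by rewrite lt_neqAle eq_sym w0 addr_ge0 //; lra.
pose l := (v - u) / (s + (v - u)).
have l0 : 0 <= l by apply: divr_ge0; lra.
have l1 : l <= 1 by rewrite ler_pdivrMr // mul1r; lra.
have l1' : 0 <= 1 - l by lra.
have l1'' : 1 - l <= 1 by lra.
have := fl _ _ _ sv0 u0 l0 l1; have := fl _ _ _ sv0 u0 l1' l1''.
rewrite subKr.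
have -> : l * (s + v) + (1 - l) * u = v.
  by rewrite /l; field.
have -> : (1 - l) * (s + v) + l * u = s + u.
  by rewrite /l; field.
move=> h1 h2.
have := ler_pM _ _ h2 h1; rewrite !mulr_ge0 ?powR_ge0 // => /(_ isT isT).
apply: le_trans.
rewrite mulrACA -!powRD ?fu0 ?fsv ?implybT //.
by rewrite subrKC subrK !powRr1 ?f0.
Qed.

(** * Tails of monotone log-concave densities *)

Section Tail.
Context {R : realType}.
Local Notation mu := (@lebesgue_measure R).
Variable f : R -> R.
Hypothesis fd : monotone_density f.

(* Extending f by the constant f 0 to the left of 0 makes it monotone, hence
   measurable, on the whole line, and translates of it stay in this class. *)
Let g (t : R) := f (Num.max 0 t).

Let gE t : 0 <= t -> g t = f t.
Proof. by move=> t0; rewrite /g max_r. Qed.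

Let g_ge0 t : 0 <= g t.
Proof. by case: fd => _ + _ _; apply; rewrite le_max lexx. Qed.

Let mg (D : set R) : measurable D -> measurable_fun D g.
Proof.
move=> mD; apply: nonincreasing_measurable => // s t st.
by case: fd => _ _ + _; apply; [rewrite le_max lexx | rewrite ge_max !le_max lexx st orbT].
Qed.

Let mEg (D : set R) : measurable D -> measurable_fun D (fun t => (g t)%:E).
Proof. by move=> mD; apply/measurable_EFinP; exact: mg. Qed.

Let tailE (s : R) : 0 <= s -> tail f s = (\int[mu]_(t in `[s, +oo[) (g t)%:E)%E.
Proof.
move=> s0; apply: eq_integral => t; rewrite inE /= in_itv /= andbT => st.
by rewrite gE // (le_trans s0).
Qed.

Lemma tail_ge0 (s : R) : 0 <= s -> (0 <= tail f s)%E.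
Proof. by move=> s0; rewrite tailE //; apply: integral_ge0 => t _; rewrite lee_fin g_ge0. Qed.

Lemma tail0 : tail f 0 = 1%E.
Proof. by case: fd. Qed.

Let tail_split (s t : R) : 0 <= s -> s <= t ->
  (tail f s = \int[mu]_(u in `[s, t[) (g u)%:E + tail f t)%E.
Proof.
move=> s0 st; rewrite !tailE ?(le_trans s0) //.
rewrite (@itv_bndbnd_setU _ _ _ (BLeft t)) ?bnd_simp //.
rewrite ge0_integral_setU //=; [by apply: mEg; exact: measurableU|by move=> x _; rewrite lee_fin g_ge0|].
by apply/disj_setPS => u [/=]; rewrite !in_itv /= => /andP[_ ut]; rewrite andbT leNgt ut.
Qed.

Lemma le_tail (s t : R) : 0 <= s -> s <= t -> (tail f t <= tail f s)%E.
Proof.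
by move=> s0 st; rewrite (tail_split s0 st) leeDr // integral_ge0 // => u _; rewrite lee_fin g_ge0.
Qed.

Lemma tail_fin_num (s : R) : 0 <= s -> tail f s \is a fin_num.
Proof.
move=> s0; rewrite ge0_fin_numE ?tail_ge0 //.
by rewrite (le_lt_trans (le_tail (lexx 0) s0)) // tail0 ltry.
Qed.

(** The integral of f over [0, x] is continuous in x and tends to 1, so the
intermediate value theorem applies to it. *)
Lemma tail_surj (p : R) : 0 < p -> p <= 1 -> exists2 s, 0 <= s & tail f s = p%:E.
Proof.
move=> p0 p1.
have intg b : 0 <= b -> mu.-integrable `[0, b] (EFin \o g).
  move=> b0; apply/integrableP; split; first exact: mEg.
  apply: (@le_lt_trans _ _ (tail f 0)); last by rewrite tail0 ltry.
  rewrite tailE //.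
  under eq_integral => t _ do rewrite /= ger0_norm //.
  apply: ge0_subset_integral => //=; [exact: mEg | by move=> t _; rewrite lee_fin | ].
  by move=> t /=; rewrite !in_itv /= => /andP[t0 _]; rewrite t0.
have cl t : (\int[mu]_(u in `[0%R, t[) (g u)%:E = \int[mu]_(u in `[0%R, t]) (g u)%:E)%E.
  by apply: integral_itv_bndo_bndc; exact: mEg.
have [n Hn] : exists n : nat, ((1 - p)%:E <= \int[mu]_(u in `[0%R, n%:R]) (g u)%:E)%E.
  apply: contrapT => /forallNP Hn.
  have := @ge0_cvgn_integral R mu g g_ge0 (mg measurableT).
  rewrite -tailE // tail0 => /cvg_lim H.
  have : (limn (fun n : nat => \int[mu]_(u in `[0%R, n%:R]) (g u)%:E) <= (1 - p)%:E)%E.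
    apply: lime_le.
      by apply/cvg_ex; exists 1%E; rewrite -tail0 tailE //; exact: ge0_cvgn_integral (mg measurableT).
    by apply: nearW => n; rewrite leNgt; apply/negP => /ltW /Hn.
  by rewrite H // lee_fin; lra.
have n0 : (0 : R) <= n%:R by [].
have := @IVT R (fun x => parameterized_integral mu 0 x g) 0 n%:R (1 - p) n0.
case.
- exact: parameterized_integral_continuous (intg _ n0).
- rewrite /parameterized_integral set_itv1 Rintegral_set1.
  have H0 : (1 - p <= \int[mu]_(u in `[0, n%:R]) g u).
    rewrite -lee_fin /Rintegral fineK //.
    exact: integrable_fin_num (intg _ n0).
  by rewrite min_l ?(max_r) ?H0 ?andbT; lra.
move=> c; rewrite in_itv /= => /andP[c0 cn] Hc; exists c => //.
have := tail_split (lexx 0) c0; rewrite tail0 cl.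
have -> : (\int[mu]_(u in `[0%R, c]) (g u)%:E = (1 - p)%:E)%E.
  by rewrite -Hc fineK //; exact: integrable_fin_num (intg _ c0).
have := tail_fin_num c0; case: (tail f c) => // r _.
by rewrite -EFinD => -[] H; congr (_%:E); lra.
Qed.

Hypothesis fl : log_concave f.

(** Integrating [log_concave_exchange] over v >= t gives
f(u) F(s + t) <= f(s + u) F(t) for u <= t.  Integrating this over u in [0, t]
gives (1 - F(t)) F(s + t) <= (F(s) - F(s + t)) F(t), and the products
F(t) F(s + t) cancel. *)
Lemma tail_submul (s t : R) : 0 <= s -> 0 <= t -> (tail f (s + t) <= tail f s * tail f t)%E.
Proof.
move=> s0 t0; have st0 : 0 <= s + t by rewrite addr_ge0.
have mgs (D : set R) : measurable D -> measurable_fun D (fun v => (g (s + v))%:E).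
  move=> mD; apply/measurable_EFinP; apply: nonincreasing_measurable => // x y xy.
  rewrite /g; case: fd => _ _ + _; apply; first by rewrite le_max lexx.
  by rewrite ge_max !le_max lexx lerD2l xy orbT.
have shift a : 0 <= a -> (tail f (s + a) = \int[mu]_(v in `[a, +oo[) (g (s + v))%:E)%E.
  move=> a0; rewrite tailE ?addr_ge0 // (ge0_integral_shift (f := fun x => (g x)%:E)) //.
  exact: mEg.
have step u : 0 <= u -> u <= t -> ((g u)%:E * tail f (s + t) <= (g (s + u))%:E * tail f t)%E.
  move=> u0 ut; rewrite shift // tailE // -!ge0_integralZl_EFin //=;
    [|by move=> v _; rewrite lee_fin|exact: mEg|by move=> v _; rewrite lee_fin|exact: mgs].
  apply: ge0_le_integral => //=.
  - by move=> v _; rewrite -EFinM lee_fin mulr_ge0.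
  - by apply: emeasurable_funM; [exact: measurable_cst | exact: mgs].
  - by apply: emeasurable_funM; [exact: measurable_cst | exact: mEg].
  move=> v; rewrite in_itv /= andbT => tv; have uv := le_trans ut tv.
  have v0 := le_trans u0 uv.
  rewrite -!EFinM lee_fin !gE ?addr_ge0 // mulrC [leRHS]mulrC.
  by apply: log_concave_exchange => //; case: fd.
have int_step : (tail f (s + t) * \int[mu]_(u in `[0%R, t[) (g u)%:E <=
                 tail f t * \int[mu]_(u in `[0%R, t[) (g (s + u))%:E)%E.
  rewrite -!ge0_integralZl //; [|exact: mgs|by move=> v _; rewrite lee_fin|exact: tail_ge0
    |exact: mEg|by move=> v _; rewrite lee_fin|exact: tail_ge0].
  apply: ge0_le_integral => //=.
  - by move=> v _; rewrite mule_ge0 ?tail_ge0 // lee_fin.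
  - by apply: emeasurable_funM; [exact: measurable_cst | exact: mEg].
  - by apply: emeasurable_funM; [exact: measurable_cst | exact: mgs].
  by move=> u; rewrite in_itv /= => /andP[u0 /ltW ut]; rewrite muleC [leRHS]muleC step.
have sum1 := tail_split (lexx 0) t0.
have sum2 : (tail f s = \int[mu]_(u in `[0%R, t[) (g (s + u))%:E + tail f (s + t))%E.
  rewrite -{1}[s]addr0 !shift //.
  rewrite (@itv_bndbnd_setU _ _ _ (BLeft t)) ?bnd_simp //.
  rewrite ge0_integral_setU //=; [by apply: mgs; exact: measurableU|by move=> x _; rewrite lee_fin g_ge0|].
  by apply/disj_setPS => u [/=]; rewrite !in_itv /= => /andP[_ ut]; rewrite andbT leNgt ut.
have := tail_fin_num s0; have := tail_fin_num t0; have := tail_fin_num st0.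
move: int_step sum1 sum2; rewrite tail0.
move: (tail f s) (tail f t) (tail f (s + t)) => [a| |] [b| |] [c| |] //=.
move: (integral _ _ _) (integral _ _ _) => [x| |] [y| |] //=.
rewrite -!EFinM -!EFinD !lee_fin => H [H1] [H2] _ _ _; nra.
Qed.
End Tail.

(** * Chaining functionals of log-concave type *)

Section Chaining.
Context {R : realType}.
Variables f h : R -> R.
Hypothesis fd : monotone_density f.
Hypothesis fh : chaining_functional f h.

(** The hypothesis on h is an equivalence about each s; it says something about
h p only because some s has tail p. *)
Lemma tail_chaining (p : R) : 0 < p -> p <= 1 -> 0 <= h p /\ tail f (h p) = p%:E.
Proof.
move=> p0 p1; have [s s0 fs] := tail_surj fd p0 p1.
by have /fh -> := fs.
Qed.

Lemma chaining_ge0 (p : R) : 0 < p -> p <= 1 -> 0 <= h p.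
Proof. by move=> p0 p1; case: (tail_chaining p0 p1). Qed.

Lemma chaining1 : h 1 = 0.
Proof. by apply/fh => //; exact: tail0. Qed.

(** The tail need not be strictly decreasing a priori, but h p is its only
preimage of p, so F s <= p still forces h p <= s.  Every inequality for h below
is derived from this one. *)
Lemma chaining_le (p s : R) : 0 < p -> p <= 1 -> 0 <= s ->
  (tail f s <= p%:E)%E -> h p <= s.
Proof.
move=> p0 p1 s0 fs; have [hp0 fhp] := tail_chaining p0 p1.
rewrite leNgt; apply/negP => sh.
have fsp : tail f s = p%:E.
  by apply/eqP; rewrite eq_le fs -{1}fhp le_tail // ltW.
by move: sh; have /fh -> := fsp; rewrite // ltxx.
Qed.

Lemma chaining_anti (p q : R) : 0 < p -> p <= q -> q <= 1 -> h q <= h p.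
Proof.
move=> p0 pq q1; have [hp0 fhp] := tail_chaining p0 (le_trans pq q1).
by apply: chaining_le => //; [exact: lt_le_trans pq | rewrite fhp lee_fin].
Qed.

Hypothesis fl : log_concave f.

Lemma chaining_submul (p q : R) : 0 < p -> p <= 1 -> 0 < q -> q <= 1 ->
  h (p * q) <= h p + h q.
Proof.
move=> p0 p1 q0 q1; have [hp0 fp] := tail_chaining p0 p1.
have [hq0 fq] := tail_chaining q0 q1.
apply: chaining_le; rewrite ?mulr_gt0 ?addr_ge0 //; first by rewrite mulr_ile1 // ltW.
by rewrite EFinM -fp -fq tail_submul.
Qed.

Lemma chaining_exp (p : R) (m : nat) : 0 < p -> p <= 1 -> h (p ^+ m) <= m%:R * h p.
Proof.
move=> p0 p1; elim: m => [|m IH]; first by rewrite expr0 chaining1 mul0r.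
rewrite exprS -natr1 mulrDl mul1r addrC.
by rewrite (le_trans (chaining_submul _ _ _ _)) ?exprn_gt0 ?exprn_ile1 ?lerD2l // ltW.
Qed.

Hypothesis hl : exists l : R, left_derivative h 1 l /\ `|l| = 1.

(** h t / (1 - t) is the absolute value of the difference quotient of h at 1,
which tends to |l| = 1. *)
Lemma chaining_near1 (d : R) : 0 < d ->
  exists2 e : R, 0 < e & forall t, 1 - e < t -> t < 1 -> h t <= (1 + d) * (1 - t).
Proof.
move=> d0; have [l [hl1 l1]] := hl.
have /cvgrPdist_le /(_ _ d0) := hl1.
move=> -[e /= e0 He]; exists e => // t et t1.
have H : `|l - h t / (t - 1)| <= d.
  have := He t; rewrite /= chaining1 subr0; apply=> //.
  by rewrite /= gtr0_norm ?subr_gt0 //; lra.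
have : `|h t / (t - 1)| <= 1 + d.
  have := ler_normD l (h t / (t - 1) - l); rewrite subrKC l1 => /le_trans; apply.
  by rewrite lerD2l distrC.
rewrite normrM normfV [`|t - 1|]distrC [`|1 - t|]gtr0_norm ?subr_gt0 //.
by rewrite ler_pdivrMr ?subr_gt0 //; apply: le_trans; exact: ler_norm.
Qed.

(** With t = p^(1/j), subadditivity gives h p <= j h t.  For large j the point t
is close to 1, where h t <= (1 + d) (1 - t) <= (1 + d) (- ln t) and
j (- ln t) = - ln p. *)
Lemma chaining_le_ln (p : R) : 0 < p -> p <= 1 -> h p <= - ln p.
Proof.
move=> p0 p1; have L0 : 0 <= - ln p by rewrite oppr_ge0 ln_le0.
have [->|pn1] := eqVneq p 1; first by rewrite chaining1 ln1 oppr0.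
have {L0}L0 : 0 < - ln p by rewrite oppr_gt0 ln_lt0 // p0 lt_neqAle pn1.
apply/ler_addgt0Pr => e e0.
pose d := e / - ln p; have d0 : 0 < d by rewrite divr_gt0.
have [eta eta0 Heta] := chaining_near1 d0.
(* m is so large that t >= 1 + ln p / m > 1 - eta. *)
pose m := (Num.bound (- ln p / eta)).
have mlt : - ln p / eta < m%:R.
  by apply: le_lt_trans (archi_boundP _); rewrite ?ler_norm // divr_ge0 ?ltW.
have m0 : (0 : R) < m%:R by apply: le_lt_trans mlt; rewrite divr_ge0 ?ltW.
pose t := expR (ln p / m%:R).
have tm : t ^+ m = p.
  by rewrite /t -expRM_natl mulrC divfK ?gt_eqF // lnK.
have t1 : t < 1.
  by rewrite /t expR_lt1 ltr_pdivrMr // mul0r -oppr_gt0.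
have t_ge : 1 + ln p / m%:R <= t by exact: expR_ge1Dx.
have et : 1 - eta < t.
  apply: lt_le_trans t_ge; rewrite ltrD2l ltrNl -mulNr.
  by rewrite ltr_pdivrMr // mulrC -ltr_pdivrMr.
rewrite -{1}tm (le_trans (chaining_exp _ _ (ltW t1))) ?expR_gt0 //.
apply: (@le_trans _ _ (m%:R * ((1 + d) * (- ln p / m%:R)))).
  rewrite ler_wpM2l ?ler0n // (le_trans (Heta _ et t1)) //.
  apply: ler_wpM2l; first by rewrite addr_ge0 // ltW.
  by rewrite mulNr lerNr opprB lerBrDl.
rewrite mulrCA [m%:R * _]mulrC divfK ?gt_eqF // mulrDl mul1r /d divfK //.
by rewrite gt_eqF.
Qed.
End Chaining.

(** - ln is decreasing and p - p ln p is its antiderivative, so the rectangle of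
width a - b and height - ln a lies under the graph of - ln over [b, a]. *)
Lemma entropy_step (R : realType) (a b : R) : 0 <= b -> b <= a -> 0 < a ->
  (a - b) * - ln a <= (a - a * ln a) - (b - b * ln b).
Proof.
move=> b0 ba a0; have [->|bn0] := eqVneq b 0; first by rewrite !mul0r; lra.
have bp : 0 < b by rewrite lt_neqAle eq_sym bn0.
have : 1 + ln (a / b) <= expR (ln (a / b)) by exact: expR_ge1Dx.
rewrite lnK ?posrE ?divr_gt0 // ln_div ?posrE // => H.
have : b * (1 + (ln a - ln b)) <= b * (a / b) by rewrite ler_wpM2l.
by rewrite [b * (a / b)]mulrC divfK //; lra.
Qed.

(** * Integrals of functions of the sublevel sets of a finite family of distances *)

(** The sublevel sets of d grow with the radius r, and each of them is the
sublevel set of its last element, last in the order by distance and then by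
label.  The element j is last exactly for r in [d j, nxt j[, where nxt j is the
distance of its successor.  For the overall last element this interval should
be infinite, but its sublevel set is everything, where phi vanishes; this is
why nxt is constrained only at elements that have a later one. *)
Section StepFunction.
Context {R : realType} {n : nat}.
Local Notation mu := (@lebesgue_measure R).
Variables (d nxt : 'I_n -> R) (phi : {set 'I_n} -> R).

Definition level (r : R) : {set 'I_n} := [set i | d i <= r]%SET.

(** Lexicographic order on (d i, i), written with the comparisons that a program
can test. *)
Definition later (j i : 'I_n) : bool :=
  (d j <= d i) && ~~ ((d i <= d j) && (i <= j)%N).

Hypothesis d_ge0 : forall i, 0 <= d i.
Hypothesis d_eq0 : exists i, d i = 0.
Hypothesis nxt_ge : forall j, d j <= nxt j.
Hypothesis nxt_le : forall j i, later j i -> nxt j <= d i.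
Hypothesis nxt_eq : forall j i, later j i -> exists2 k, later j k & nxt j = d k.
Hypothesis phiT : phi [set: 'I_n]%SET = 0.

Let later_total i j : i != j -> later i j || later j i.
Proof.
rewrite /later => ij; have nij : (i : nat) != j by [].
by case: (ltgtP (d i) (d j)) => //= _; rewrite -!ltnNge -neq_ltn.
Qed.

Lemma last_in_level (r : R) : 0 <= r ->
  exists2 j, d j <= r & forall i, later j i -> r < d i.
Proof.
move=> r0; have [i0 di0] := d_eq0.
have i0r : d i0 <= r by rewrite di0.
have [i1 i1r i1max] := @arg_maxP _ _ _ i0 (fun i => d i <= r) d i0r.
have i11 : d i1 == d i1 by [].
have [j /eqP ji1 jmax] := @arg_maxnP _ i1 (fun i => d i == d i1) (@nat_of_ord n) i11.
exists j; first by rewrite ji1.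
move=> i /andP[ji]; rewrite ltNge; apply: contra => ir.
have ii1 : d i <= d i1 by exact: i1max.
rewrite ji1 ii1 /=; apply: jmax.
by rewrite eq_le ii1 -ji1.
Qed.

Lemma level_step (r : R) : 0 <= r ->
  phi (level r) = \sum_j phi (level (d j)) * \1_(`[d j, nxt j[%classic) r.
Proof.
move=> r0; have [j0 j0r j0max] := last_in_level r0.
have lev : level (d j0) = level r.
  apply/setP => i; rewrite !inE; apply/idP/idP => [/le_trans|ir]; first exact.
  rewrite leNgt; apply/negP => j0i.
  by have := j0max i; rewrite /later (ltW j0i) /= leNgt j0i /= ltNge ir => /(_ isT).
rewrite (bigD1 j0) //= [X in _ + X]big1 ?addr0 => [|j jj0]; last first.
  rewrite indicE; case: (boolP (r \in _)) => [|_]; last by rewrite mulr0.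
  rewrite inE /= in_itv /= => /andP[jr rj].
  have [jj0l|j0j] := orP (later_total jj0).
    by move: rj; rewrite ltNge (le_trans (nxt_le jj0l)).
  by move: jr; rewrite leNgt j0max.
rewrite lev indicE; have [[i j0i]|nolater] := pselect (exists i, later j0 i).
  rewrite mem_set ?mulr1 //= in_itv /= j0r /=.
  by have [k j0k ->] := nxt_eq j0i; exact: j0max.
rewrite (_ : level r = [set: 'I_n]%SET) ?phiT ?mul0r //.
apply/setP => i; rewrite !inE; have [->//|ij0] := eqVneq i j0.
have /orP[/andP[/le_trans ij _]|j0i] := later_total ij0; first exact: ij.
by case: nolater; exists i.
Qed.

Let mstep j (D : set R) : measurable D -> measurable_fun D
  (fun r => (phi (level (d j)) * \1_(`[d j, nxt j[%classic) r)%:E).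
Proof.
move=> mD; apply/measurable_EFinP/measurable_funM; first exact: measurable_cst.
exact: measurable_indic.
Qed.

Lemma measurable_level :
  measurable_fun (`[0, +oo[%classic : set R) (fun r => (phi (level r))%:E).
Proof.
apply: (@eq_measurable_fun _ _ _ _ _ (fun r =>
  (\sum_(j <- index_enum 'I_n) (phi (level (d j)) * \1_(`[d j, nxt j[%classic) r)%:E)%E)).
  by move=> r; rewrite inE /= in_itv /= andbT => r0; rewrite sumEFin level_step.
by apply: emeasurable_sum => j; exact: mstep.
Qed.

Lemma integral_level : (forall r, 0 <= r -> 0 <= phi (level r)) ->
  (\int[mu]_(r in `[0%R, +oo[) (phi (level r))%:E =
   (\sum_j phi (level (d j)) * (nxt j - d j))%:E)%E.
Proof.
move=> phi0.
under eq_integral.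
  move=> r; rewrite inE /= in_itv /= andbT => r0.
  rewrite level_step // -sumEFin.
  over.
rewrite ge0_integral_sum //=; first last.
- by move=> j r _; rewrite lee_fin mulr_ge0 ?phi0.
- by move=> j; exact: mstep.
rewrite -sumEFin; apply: eq_bigr => j _.
under eq_integral do rewrite EFinM.
rewrite ge0_integralZl_EFin ?phi0 //=; first last.
  by apply/measurable_EFinP; exact: measurable_indic.
rewrite integral_indic // EFinM; congr (_ * _)%E.
rewrite (_ : _ `&` _ = `[d j, nxt j[%classic); last first.
  apply/setIidl => r /=; rewrite !in_itv /= andbT => /andP[+ _].
  by apply: le_trans.
rewrite [LHS]lebesgue_measure_itv /= lte_fin; case: ltP => // h.
by congr _%:E; apply/eqP; rewrite eq_sym subr_eq0 eq_le h nxt_ge.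
Qed.
End StepFunction.

(** * Running time, frame rule and loop rule for the real RAM *)

Section Cost.

(** When every loop runs n times, the cost of a command is bounded by a
polynomial in n that does not depend on the state. *)
Fixpoint size_loops (c : cmd) : bool :=
  match c with
  | Skip | NSet _ _ _ | RSet _ _ _ | Emit _ => true
  | Seq c1 c2 | If _ c1 c2 => size_loops c1 && size_loops c2
  | For _ NSize c1 => size_loops c1
  | For _ _ _ => false
  end.

Fixpoint cost_bound (n : nat) (c : cmd) : nat :=
  match c with
  | Skip => 1
  | NSet _ i e => (ncost i + ncost e).+1
  | RSet _ i e => (ncost i + rcost e).+1
  | Emit i => (ncost i).+1
  | Seq c1 c2 => (cost_bound n c1 + cost_bound n c2).+1
  | If b c1 c2 => (bcost b + cost_bound n c1 + cost_bound n c2).+1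
  | For _ e c1 => (ncost e + n * (cost_bound n c1).+1).+1
  end%N.

Fixpoint loop_depth (c : cmd) : nat :=
  match c with
  | Seq c1 c2 | If _ c1 c2 => maxn (loop_depth c1) (loop_depth c2)
  | For _ _ c1 => (loop_depth c1).+1
  | _ => 0
  end.

Lemma clock_run (R : realType) (inp : input R) (c : cmd) (s : state R) :
  size_loops c ->
  (clock (run inp c s) <= clock s + cost_bound (in_size inp) c)%N.
Proof.
elim: c s => [|a i e|a i e|i|c1 IH1 c2 IH2|b c1 IH1 c2 IH2|a e c IH] s //=.
- case/andP=> h1 h2; rewrite (leq_trans (IH2 _ h2)) //.
  by have := IH1 (tick 1 s) h1; rewrite /=; lia.
- case/andP=> h1 h2; case: ifP => _.
    by rewrite (leq_trans (IH1 _ h1)) //=; lia.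
  by rewrite (leq_trans (IH2 _ h2)) //=; lia.
case: e => // h /=.
suff : forall m s1, (clock (iteri m (fun i s' => run inp c (tick 1 (nset a 0 i s'))) s1)
    <= clock s1 + m * (cost_bound (in_size inp) c).+1)%N.
  by move=> /(_ (in_size inp) (tick 2 s)) /=; lia.
elim=> [|m IHm] s1 /=; first by lia.
rewrite (leq_trans (IH _ h)) //=; have := IHm s1; lia.
Qed.

(** A polynomial with natural coefficients and of degree at most k is at most
its value at 1 times n ^ k. *)
Lemma cost_bound_poly (n k : nat) (c : cmd) : (0 < n)%N -> (loop_depth c <= k)%N ->
  (cost_bound n c <= cost_bound 1 c * n ^ k)%N.
Proof.
move=> n0; have pos j : (0 < n ^ j)%N by rewrite expn_gt0 n0.
elim: c k => [|a i e|a i e|i|c1 IH1 c2 IH2|b c1 IH1 c2 IH2|a e c IH] k /=;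
  try by move=> _; rewrite leq_pmulr.
- by rewrite geq_max => /andP[/IH1 h1 /IH2 h2]; have := pos k; nia.
- by rewrite geq_max => /andP[/IH1 h1 /IH2 h2]; have := pos k; nia.
case: k => // k; rewrite ltnS => /IH h.
rewrite expnS; have := pos k; nia.
Qed.

End Cost.

Section Frame.
Context {R : realType}.
Variable inp : input R.

Fixpoint nwrites (c : cmd) : seq nat :=
  match c with
  | NSet a _ _ => [:: a]
  | Seq c1 c2 | If _ c1 c2 => nwrites c1 ++ nwrites c2
  | For a _ c1 => a :: nwrites c1
  | _ => [::]
  end.

Fixpoint rwrites (c : cmd) : seq nat :=
  match c with
  | RSet a _ _ => [:: a]
  | Seq c1 c2 | If _ c1 c2 => rwrites c1 ++ rwrites c2
  | For _ _ c1 => rwrites c1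
  | _ => [::]
  end.

Fixpoint emits (c : cmd) : bool :=
  match c with
  | Emit _ => true
  | Seq c1 c2 | If _ c1 c2 => emits c1 || emits c2
  | For _ _ c1 => emits c1
  | _ => false
  end.

Lemma run_seq (c1 c2 : cmd) (s : state R) :
  run inp (Seq c1 c2) s = run inp c2 (run inp c1 (tick 1 s)).
Proof. by []. Qed.

Lemma run_if (b : bexp) (c1 c2 : cmd) (s : state R) :
  run inp (If b c1 c2) s =
  if beval inp s b then run inp c1 (tick (bcost b).+1 s)
  else run inp c2 (tick (bcost b).+1 s).
Proof. by []. Qed.

Lemma nmem_frame (c : cmd) (s : state R) (b : nat) :
  b \notin nwrites c -> nmem (run inp c s) b = nmem s b.
Proof.
elim: c s => [|a i e|a i e|i|c1 IH1 c2 IH2|t c1 IH1 c2 IH2|a e c IH] s //=.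
- by rewrite inE /upd => /negbTE ->.
- by rewrite mem_cat negb_or => /andP[/IH1 h1 /IH2 ->]; rewrite h1.
- by rewrite mem_cat negb_or => /andP[/IH1 h1 /IH2 h2]; case: ifP; rewrite ?h1 ?h2.
rewrite inE negb_or => /andP[/negbTE ba /IH h].
by elim: (neval _ _ _) => //= m <-; rewrite h /= /upd ba.
Qed.

Lemma rmem_frame (c : cmd) (s : state R) (b : nat) :
  b \notin rwrites c -> rmem (run inp c s) b = rmem s b.
Proof.
elim: c s => [|a i e|a i e|i|c1 IH1 c2 IH2|t c1 IH1 c2 IH2|a e c IH] s //=.
- by rewrite inE /upd => /negbTE ->.
- by rewrite mem_cat negb_or => /andP[/IH1 h1 /IH2 ->]; rewrite h1.
- by rewrite mem_cat negb_or => /andP[/IH1 h1 /IH2 h2]; case: ifP; rewrite ?h1 ?h2.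
by move=> /IH h; elim: (neval _ _ _) => //= m <-; rewrite h.
Qed.

Lemma output_frame (c : cmd) (s : state R) :
  ~~ emits c -> output (run inp c s) = output s.
Proof.
elim: c s => [|a i e|a i e|i|c1 IH1 c2 IH2|t c1 IH1 c2 IH2|a e c IH] s //=.
- by rewrite negb_or => /andP[/IH1 h1 /IH2 ->]; rewrite h1.
- by rewrite negb_or => /andP[/IH1 h1 /IH2 h2]; case: ifP; rewrite ?h1 ?h2.
by move=> /IH h; elim: (neval _ _ _) => //= m <-; rewrite h.
Qed.

(** What a command cannot have changed, read off its syntax.  All three clauses
are decided by computation for a concrete program, so that correctness lemmas
only describe what a command does to the arrays of interest. *)
Definition agree_outside (c : cmd) (s s' : state R) : Prop :=
  [/\ forall b, b \notin nwrites c -> nmem s' b = nmem s b,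
      forall b, b \notin rwrites c -> rmem s' b = rmem s b
    & ~~ emits c -> output s' = output s].

(** Besides the invariant, the body may assume that everything the loop does not
write is as it was before the loop.  The second premise, stability of the
invariant under setting the loop variable, holds by conversion for invariants
about other arrays. *)
Lemma run_for (I : nat -> state R -> Prop) (a : nat) (c : cmd)
    (s : state R) :
  I 0 (tick 2 s) ->
  (forall i s', I i s' -> I i (tick 1 (nset a 0 i s'))) ->
  (forall i s', (i < in_size inp)%N -> nmem s' a 0 = i ->
     agree_outside (For a NSize c) s s' -> I i s' -> I i.+1 (run inp c s')) ->
  I (in_size inp) (run inp (For a NSize c) s).
Proof.
move=> I0 Itick Istep /=; set m := in_size inp.
pose body i s' := run inp c (tick 1 (nset a 0 i s')).
suff : forall k, (k <= m)%N ->
    agree_outside (For a NSize c) s (iteri k body (tick 2 s)) /\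
    I k (iteri k body (tick 2 s)) by case/(_ m (leqnn m)).
elim=> [|k IHk] km; first by split => //; split.
have [[An Ar Ao] Ik] := IHk (ltnW km); rewrite /=.
set s1 := iteri k _ _ in An Ar Ao Ik *; rewrite /body.
have A1 : agree_outside (For a NSize c) s (tick 1 (nset a 0 k s1)).
  split=> //= b; rewrite inE negb_or => /andP[ba bc].
  by rewrite /upd (negbTE ba) An // inE negb_or ba.
split; last first.
  by apply: Istep => //=; [rewrite /upd !eqxx | exact: Itick].
case: A1 => Bn Br Bo; split=> [b nb|b nb|nb].
- by rewrite nmem_frame ?Bn //; move: nb; rewrite /= inE negb_or => /andP[].
- by rewrite rmem_frame ?Br.
- by rewrite output_frame ?Bo.
Qed.

End Frame.

(** * The greedy program *)

Section Program.

(* Arrays of natural numbers.  The first four are loop variables.  Tables indexed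
   by pairs of labels are stored by rows, and since index expressions have no
   product, cell x of nRow holds x * n.  The flags nAlive describe the current
   set S and the flags nKept the best set seen so far.  The scalar nCand holds
   0 for no candidate, and z + 1 for the candidate z. *)
Local Notation nX := 0%N.
Local Notation nY := 1%N.
Local Notation nZ := 2%N.
Local Notation nRound := 3%N.
Local Notation nRow := 4%N.
Local Notation nAlive := 5%N.
Local Notation nKept := 6%N.
Local Notation nCand := 7%N.
(* Arrays of reals: two tables, then scalars.  At (x, y), rGap holds the gap
   following d(x, y) and rBall the mass of S within d(x, y) of x.  The scalar
   rTot holds the mass of S. *)
Local Notation rGap := 0%N.
Local Notation rBall := 1%N.
Local Notation rAcc := 2%N.
Local Notation rLow := 3%N.
Local Notation rBest := 4%N.
Local Notation rTot := 5%N.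

Local Notation X := (NCell nX (NLit 0)).
Local Notation Y := (NCell nY (NLit 0)).
Local Notation Z := (NCell nZ (NLit 0)).
Local Notation XY := (NAdd (NCell nRow X) Y).
Local Notation scalar a := (RCell a (NLit 0)).
Local Notation set_scalar a e := (RSet a (NLit 0) e).
Local Notation holds a i := (BNle (NLit 1) (NCell a i)).
Local Notation when b c := (If b c Skip).

Definition for_pairs (c : cmd) : cmd := For nX NSize (For nY NSize c).

Definition set_rows : cmd :=
  For nX NSize (NSet nRow (NAdd X (NLit 1)) (NAdd (NCell nRow X) NSize)).

(** The search for the least later distance starts from the sum of all distances
from x, which bounds each of them. *)
Definition set_gap : cmd :=
  Seq (set_scalar rAcc (RLit 0))
 (Seq (For nZ NSize (set_scalar rAcc (RAdd (scalar rAcc) (RDist X Z))))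
 (Seq (For nZ NSize
        (when (BAnd (BAnd (BRle (RDist X Y) (RDist X Z))
                          (BNot (BAnd (BRle (RDist X Z) (RDist X Y)) (BNle Z Y))))
                    (BRle (RDist X Z) (scalar rAcc)))
              (set_scalar rAcc (RDist X Z))))
      (RSet rGap XY (RSub (scalar rAcc) (RDist X Y))))).

Definition add_or_sub (ins : bool) (e1 e2 : rexp) : rexp :=
  if ins then RAdd e1 e2 else RSub e1 e2.

(** Inserting a point in S and deleting one are the same update up to sign, so
the initial tables are built by inserting the support into the empty set. *)
Definition move_point (ins : bool) (z : nexp) : cmd :=
  Seq (NSet nAlive z (NLit ins))
 (Seq (set_scalar rTot (add_or_sub ins (scalar rTot) (RMass z)))
      (for_pairs (when (BRle (RDist X z) (RDist X Y))
                       (RSet rBall XY (add_or_sub ins (RCell rBall XY) (RMass z)))))).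

Definition insert_support : cmd :=
  For nZ NSize
    (when (BNot (BRle (RMass Z) (RLit 0)))
          (Seq (move_point true Z) (NSet nKept Z (NLit 1)))).

(** The test before the update reads: there is no candidate, or the new value is
at most that of the candidate. *)
Definition find_least : cmd :=
  Seq (NSet nCand (NLit 0) (NLit 0))
      (For nX NSize
        (when (holds nAlive X)
          (Seq (set_scalar rAcc (RLit 0))
          (Seq (For nY NSize
                 (set_scalar rAcc (RAdd (scalar rAcc)
                    (RMul (ROracle (RDiv (RCell rBall XY) (scalar rTot))) (RCell rGap XY)))))
               (when (BNot (BAnd (holds nCand (NLit 0)) (BNot (BRle (scalar rAcc) (scalar rLow)))))
                 (Seq (NSet nCand (NLit 0) (NAdd X (NLit 1)))
                      (set_scalar rLow (scalar rAcc)))))))).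

Definition keep_if_best : cmd :=
  when (BRle (scalar rBest) (scalar rLow))
    (Seq (set_scalar rBest (scalar rLow))
         (For nX NSize (NSet nKept X (NCell nAlive X)))).

Definition remove_least : cmd :=
  Seq find_least
      (when (holds nCand (NLit 0))
        (Seq keep_if_best (move_point false (NSub (NCell nCand (NLit 0)) (NLit 1))))).

Definition emit_kept : cmd := For nX NSize (when (holds nKept X) (Emit X)).

Definition greedy_program : cmd :=
  Seq set_rows (Seq (for_pairs set_gap) (Seq insert_support
  (Seq (For nRound NSize remove_least) emit_kept))).

Lemma greedy_program_cost (R : realType) (inp : input R) :
  (0 < in_size inp)%N ->
  (clock (run inp greedy_program (init (R := R))) <=
     cost_bound 1 greedy_program * in_size inp ^ 3)%N.
Proof.
move=> n0; apply: leq_trans (clock_run _ _ _) _ => //.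
by rewrite add0n; exact: cost_bound_poly.
Qed.

Section Correctness.
Context {R : realType}.
Variable inp : input R.
Local Notation n := (in_size inp).
Local Notation d := (in_dist inp).
Local Notation m := (in_mass inp).
Implicit Types (S B : {set 'I_n}) (s : state R).

Definition later_label (x y z : nat) : bool :=
  (d x y <= d x z) && ~~ ((d x z <= d x y) && (z <= y)%N).

Definition next_dist (x y : nat) : R :=
  iteri n (fun z v => if later_label x y z && (d x z <= v) then d x z else v)
    (\sum_(0 <= z < n) d x z).

Definition ball_mass S (x y : nat) : R := \sum_(z in S | d x z <= d x y) m z.

Definition total_mass S : R := \sum_(z in S) m z.

Definition chain_sum S (x : nat) : R :=
  \sum_(0 <= y < n) in_oracle inp (ball_mass S x y / total_mass S) *
                    (next_dist x y - d x y).

Definition rows_ok s : Prop := forall x : nat, (x <= n)%N -> nmem s nRow x = (x * n)%N.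

Lemma pair_index_inj (x x' y y' : nat) : (y < n)%N -> (y' < n)%N ->
  (x * n + y == x' * n + y')%N = (x == x') && (y == y').
Proof.
move=> yn yn'; apply/eqP/andP => [h|[/eqP-> /eqP->]] //.
have n0 : (0 < n)%N by apply: leq_trans yn.
have := congr1 (divn^~ n) h; rewrite !divnMDl // !divn_small // !addn0 => ->.
by have := congr1 (modn^~ n) h; rewrite !modnMDl !modn_small // => ->.
Qed.

Lemma run_set_rows s : nmem s nRow 0 = 0%N -> rows_ok (run inp set_rows s).
Proof.
move=> s0; rewrite /set_rows /rows_ok.
apply: (@run_for _ inp (fun i s' => forall x : nat, (x <= i)%N -> nmem s' nRow x = (x * n)%N)).
- by case.
- by [].
move=> i s' _ si _ IH x; rewrite /= /upd /= si addn1.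
case: eqVneq => [->|xi] xle; first by rewrite IH // mulSn addnC.
by apply: IH; rewrite -ltnS ltn_neqAle xi.
Qed.

(** Each pass of the inner loop changes one cell of the table t, and the cells of
different pairs are distinct, so the cell of (x, y) is updated once, from its
value before the loops. *)
Lemma run_for_pairs (c : cmd) (t : nat) (F : nat -> nat -> R -> R) s :
  rows_ok s ->
  nX \notin nwrites c -> nY \notin nwrites c -> nRow \notin nwrites c ->
  (forall s' (x y : nat), (x < n)%N -> (y < n)%N -> agree_outside (for_pairs c) s s' ->
     nmem s' nX 0 = x -> nmem s' nY 0 = y ->
     forall k, rmem (run inp c s') t k =
       if k == (x * n + y)%N then F x y (rmem s' t k) else rmem s' t k) ->
  forall x y : nat, (x < n)%N -> (y < n)%N ->
    rmem (run inp (for_pairs c) s) t (x * n + y)%N = F x y (rmem s t (x * n + y)%N).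
Proof.
move=> rows cX cY cR Hc.
pose upto (i j : nat) s' := forall x y : nat, (x < n)%N -> (y < n)%N ->
  rmem s' t (x * n + y)%N =
  if (x < i)%N || (x == i) && (y < j)%N then F x y (rmem s t (x * n + y)%N)
  else rmem s t (x * n + y)%N.
suff : upto n 0 (run inp (for_pairs c) s).
  by move=> H x y xn yn; rewrite H // xn.
apply: (@run_for _ inp (fun i => upto i 0)) => //.
  by move=> x y _ _; rewrite ltn0 andbF.
move=> i s1 /= iN s1X [A1n A1r A1o] H1.
suff : upto i n (run inp (For nY NSize c) s1).
  move=> H x y xn yn; rewrite H // ltn0 andbF orbF yn andbT [(x < i.+1)%N]ltnS.
  by case: (ltngtP x i).
apply: (@run_for _ inp (fun j => upto i j)) => //.
move=> j s2 /= jN s2Y [A2n A2r A2o] H2 x y xn yn.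
have s2X : nmem s2 nX 0 = i by rewrite A2n // inE.
have A : agree_outside (for_pairs c) s s2.
  split=> /= [b nb|b nb|nb].
  - rewrite A2n ?A1n //; by move: nb; rewrite !inE !negb_or => /andP[].
  - by rewrite A2r ?A1r.
  - by rewrite A2o ?A1o.
rewrite (Hc s2 i j) // pair_index_inj // H2 //.
by case: (ltngtP x i) => //= ->; rewrite ltnS; case: (ltngtP y j) => //= ->.
Qed.

Lemma run_sum (a : nat) (e : rexp) (F : nat -> R) s :
  rmem s rAcc 0 = 0 ->
  (forall s' i, (i < n)%N -> nmem s' a 0 = i ->
     agree_outside (For a NSize (set_scalar rAcc (RAdd (scalar rAcc) e))) s s' ->
     reval inp s' e = F i) ->
  rmem (run inp (For a NSize (set_scalar rAcc (RAdd (scalar rAcc) e))) s) rAcc 0 =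
  \sum_(0 <= i < n) F i.
Proof.
move=> s0 He; apply: (@run_for _ inp (fun i s' => rmem s' rAcc 0 = \sum_(0 <= j < i) F j)).
- by rewrite big_geq.
- by [].
by move=> i s' iN s'a A IH; rewrite big_nat_recr //= /upd /= IH (He s' i).
Qed.

(** The value left in rAcc by the second loop is [next_dist] by construction: the
definition repeats the loop. *)
Lemma run_set_gap s (x y : nat) : nmem s nX 0 = x -> nmem s nY 0 = y ->
  nmem s nRow x = (x * n)%N ->
  forall k, rmem (run inp set_gap s) rGap k =
    if k == (x * n + y)%N then next_dist x y - d x y else rmem s rGap k.
Proof.
move=> sX sY sR k; rewrite /set_gap !run_seq.
set s1 := run inp (set_scalar _ _) _.
set s2 := run inp (For nZ _ _) (tick 1 s1).
set s3 := run inp (For nZ _ _) (tick 1 s2).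
have s2acc : rmem s2 rAcc 0 = \sum_(0 <= z < n) d x z.
  apply: run_sum => [|s' z _ sz [An _ _]].
    by [].
  rewrite /=.
  by rewrite sz An //= sX.
have s2n b : b != nZ -> nmem s2 b = nmem s b.
  by move=> bZ; rewrite nmem_frame // !inE.
have s3n b : b != nZ -> nmem s3 b = nmem s b.
  by move=> bZ; rewrite nmem_frame ?s2n //= inE.
have s3acc : rmem s3 rAcc 0 = next_dist x y.
  apply: (@run_for _ inp (fun i s' => rmem s' rAcc 0 =
    iteri i (fun z v => if later_label x y z && (d x z <= v) then d x z else v)
    (\sum_(0 <= z < n) d x z))) => //.
  move=> i s' iN s'Z [An _ _] IH; rewrite iteriS -IH /=.
  rewrite s'Z !An //= !s2n // sX sY -/(later_label x y i).
  by case: ifP.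
have s3gap : rmem s3 rGap = rmem s rGap.
  by rewrite rmem_frame // rmem_frame.
rewrite /= /upd /= !s3n // sX sY sR s3acc s3gap.
by [].
Qed.

Definition consistent S s : Prop :=
  [/\ forall z : 'I_n, nmem s nAlive z = (z \in S),
      forall x y : nat, (x < n)%N -> (y < n)%N ->
        rmem s rBall (x * n + y)%N = ball_mass S x y
    & rmem s rTot 0 = total_mass S].

Lemma run_move_point (ins : bool) (e : nexp) S (z : 'I_n) s :
  rows_ok s -> (z \in S) = ~~ ins ->
  (forall s', agree_outside (move_point ins e) s s' -> neval inp s' e = z) ->
  consistent S s ->
  consistent (if ins then z |: S else S :\ z)%SET (run inp (move_point ins e) s).
Proof.
move=> rows zS ez [Sal Sball Stot].
set S' := (if ins then _ else _)%SET.
have inS' z' : (z' \in S') = if z' == z then ins else z' \in S.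
  by rewrite /S'; case: ins {S' ez} zS => zS; rewrite !inE; case: eqVneq.
(* Both tables of masses are sums over S of this shape, with P either the
   points within d(x, y) of x or all points. *)
have sumS' (P : pred 'I_n) : \sum_(z' in S' | P z') m z' =
    (if P z then if ins then \sum_(z' in S | P z') m z' + m z
                 else \sum_(z' in S | P z') m z' - m z
     else \sum_(z' in S | P z') m z').
  have sum_rest : \sum_(z' in S' | P z' && (z' != z)) m z' =
                  \sum_(z' in S | P z' && (z' != z)) m z'.
    by apply: eq_bigl => z'; rewrite inS'; case: eqVneq; rewrite /= ?andbF.
  have [Pz|Pz] := ifP; last first.
    rewrite -[LHS](_ : \sum_(z' in S' | P z' && (z' != z)) m z' = _); last first.
      by apply: eq_bigl => z'; case: eqVneq => [->|]; rewrite ?Pz ?andbT ?andbF.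
    rewrite sum_rest; apply: eq_bigl => z'.
    by case: eqVneq => [->|]; rewrite ?Pz ?andbT ?andbF.
  case: ifP zS => ins_ zS.
    rewrite (bigD1 z) /=; last by rewrite inS' eqxx ins_ Pz.
    under eq_bigl do rewrite -andbA.
    rewrite sum_rest addrC; congr (_ + _); apply: eq_bigl => z'.
    by case: eqVneq => [->|]; rewrite ?zS ?andbT ?andbF.
  rewrite [in RHS](bigD1 z) /=; last by rewrite zS Pz.
  under [in RHS]eq_bigl do rewrite -andbA.
  rewrite -sum_rest addrC addrK; apply: eq_bigl => z'.
  by case: eqVneq => [->|]; rewrite ?inS' ?eqxx ?ins_ ?andbT ?andbF.
rewrite /move_point !run_seq.
set s1 := run inp (NSet _ _ _) _.
set s2 := run inp (set_scalar _ _) _.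
have e0 : neval inp (tick 1 s) e = z by apply: ez; split.
have s1al k : nmem s1 nAlive k = if k == z then ins : nat else nmem s nAlive k.
  by rewrite /s1 /= /upd /= e0.
have A1 : agree_outside (move_point ins e) s (tick 1 s1).
  split=> //= b; rewrite !inE => /norP[+ _].
  by rewrite /s1 /= /upd => /negbTE ->.
have e1 := ez _ A1.
have A2 : agree_outside (move_point ins e) s s2.
  case: A1 => A1n _ _; split=> //= b nb.
  by move: nb; rewrite !inE => /norP[/negbTE bT _]; rewrite /upd bT.
have s2tot : rmem s2 rTot 0 = total_mass S'.
  have totE T : total_mass T = \sum_(z' in T | predT z') m z'.
    by apply: eq_bigl => z'; rewrite andbT.
  rewrite /s2 /= /upd /= totE sumS' /= -totE.
  by case: (ins) e1 => /= ->; rewrite Stot.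
split.
- move=> z'; rewrite nmem_frame // -[LHS]/(nmem s1 nAlive z') s1al inS' Sal.
  by rewrite -val_eqE /=; case: ifP.
- move=> x y xn yn.
  have := @run_for_pairs (when (BRle (RDist X e) (RDist X Y))
     (RSet rBall XY (add_or_sub ins (RCell rBall XY) (RMass e)))) rBall
    (fun x y v => if d x z <= d x y then if ins then v + m z else v - m z else v) s2.
  move=> H; rewrite {}H //.
  + by rewrite -[rmem s2 rBall]/(rmem s rBall) Sball // /ball_mass sumS'.
  + move=> s' x' y' xn' yn' [An Ar Ao] s'X s'Y k.
    have A3 : agree_outside (move_point ins e) s s'.
      case: A2 => B1 B2 B3; split=> [b nb|b nb|nb].
      - rewrite An ?B1 //; move: nb; rewrite /= !inE => /norP[_ nb]; exact: nb.
      - rewrite Ar ?B2 //; move: nb; rewrite /= !inE => /norP[_ nb]; exact: nb.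
      - by rewrite Ao ?B3.
    have es' := ez _ A3; have es'k j : neval inp (tick j s') e = z by exact: ez.
    have s'R : nmem s' nRow x' = (x' * n)%N by rewrite An // -[nmem s2 nRow]/(nmem s nRow) rows // ltnW.
    rewrite /= s'X s'Y es'; case: ifP => _; last by rewrite /= if_same.
    rewrite /= /upd /= ?s'X ?s'Y ?s'R; case: eqP => // ->.
    by case: (ins) => /=; rewrite ?s'X ?s'Y ?s'R ?es'k.
by rewrite rmem_frame.
Qed.

(** S is the current set, B the set to be returned and b the minimum for which B
was kept, or 0 before the first round. *)
Definition represents S B (b : R) s : Prop :=
  [/\ rows_ok s, output s = [::],
      forall x y : nat, (x < n)%N -> (y < n)%N ->
        rmem s rGap (x * n + y)%N = next_dist x y - d x y,
      consistent S s
    & (forall z : 'I_n, nmem s nKept z = (z \in B)) /\ rmem s rBest 0 = b].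

Lemma represents_agree S B b s s' :
  represents S B b s ->
  {in [:: nRow; nAlive; nKept], nmem s' =1 nmem s} ->
  {in [:: rGap; rBall; rBest; rTot], rmem s' =1 rmem s} ->
  output s' = output s -> represents S B b s'.
Proof.
case=> h1 h2 h3 [h4 h5 h6] [h7 h8] hn hr ho.
split=> //.
- by move=> x; rewrite hn //; exact: h1.
- by rewrite ho.
- by move=> x y; rewrite hr //; exact: h3.
- split.
  + by move=> z; rewrite hn.
  + by move=> x y xn yn; rewrite hr // h5.
  + by rewrite hr.
- by split=> [z|]; rewrite ?hn ?hr.
Qed.

Definition support : {set 'I_n} := [set z : 'I_n | 0 < m z]%SET.

Lemma represents_move_point (ins : bool) (e : nexp) S B b (z : 'I_n) s :
  represents S B b s -> (z \in S) = ~~ ins ->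
  (forall s', agree_outside (move_point ins e) s s' -> neval inp s' e = z) ->
  represents (if ins then z |: S else S :\ z)%SET B b (run inp (move_point ins e) s).
Proof.
case=> h1 h2 h3 h4 [h5 h6] zS ez; split.
- by move=> x; rewrite nmem_frame //; exact: h1.
- by rewrite output_frame.
- by move=> x y; rewrite rmem_frame //; exact: h3.
- exact: run_move_point.
- by split=> [z'|]; rewrite ?nmem_frame ?rmem_frame.
Qed.

Lemma run_insert_support s :
  represents finset.set0 finset.set0 0 s ->
  represents support support 0 (run inp insert_support s).
Proof.
move=> h0; pose T i : {set 'I_n} := [set z : 'I_n | (0 < m z) && (z < i)%N]%SET.
have -> : support = T n by apply/setP => z; rewrite !inE ltn_ord andbT.
apply: (@run_for _ inp (fun i => represents (T i) (T i) 0)) => //.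
  suff -> : T 0%N = finset.set0 by [].
  by apply/setP => z; rewrite !inE ltn0 andbF.
move=> i s1 iN s1Z _ IH; pose z := Ordinal iN.
rewrite run_if [beval _ _ _]/= s1Z -ltNge; case: ifPn => mi; last first.
  suff -> : T i.+1 = T i by exact: IH.
  apply/setP => z'; rewrite !inE ltnS leq_eqVlt; case: eqVneq => //= zi.
  by rewrite zi ltnn andbF andbT; apply: negbTE.
rewrite run_seq.
have -> : T i.+1 = (z |: T i)%SET.
  apply/setP => z'; rewrite !inE ltnS leq_eqVlt -val_eqE /=.
  by case: eqVneq => //= ->; rewrite mi.
set s2 := tick 1 _.
have h2 : represents (z |: T i)%SET (T i) 0 (run inp (move_point true Z) s2).
  apply: (@represents_move_point true _ _ _ _ z) => //.
    by rewrite !inE ltnn andbF.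
  by move=> s' [An _ _] /=; rewrite An.
have h2Z : nmem (run inp (move_point true Z) s2) nZ 0 = i by rewrite nmem_frame.
set s3 := run inp (move_point true Z) s2 in h2 h2Z *.
case: h2 => g1 g2 g3 g4 [g5 g6]; split=> //.
split=> // z'; rewrite /= /upd /= h2Z !inE -val_eqE /=.
by case: eqVneq => //= _; rewrite g5 !inE.
Qed.

Lemma run_chain_sum S B b s (x : nat) : represents S B b s -> (x < n)%N ->
  nmem s nX 0 = x -> rmem s rAcc 0 = 0 ->
  rmem (run inp (For nY NSize
     (set_scalar rAcc (RAdd (scalar rAcc)
       (RMul (ROracle (RDiv (RCell rBall XY) (scalar rTot))) (RCell rGap XY))))) s) rAcc 0 =
  chain_sum S x.
Proof.
case=> h1 _ h3 [_ h4 h5] _ xn sX sacc.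
apply: run_sum => // s' i iN s'Y [An Ar _].
rewrite /= s'Y !An // sX h1 ?(ltnW xn) // !Ar // h3 // h4 // h5.
by [].
Qed.

Lemma run_find_least S B b s : represents S B b s ->
  let s' := run inp find_least s in
  represents S B b s' /\
  ((S = finset.set0 /\ nmem s' nCand 0 = 0%N) \/
   exists z : 'I_n, [/\ z \in S, nmem s' nCand 0 = z.+1, rmem s' rLow 0 = chain_sum S z
     & forall x : 'I_n, x \in S -> chain_sum S z <= chain_sum S x]).
Proof.
move=> hs s'; split.
  apply: represents_agree hs _ _ _ => [a|a|].
  - by rewrite !inE => /or3P[] /eqP->; rewrite nmem_frame.
  - by rewrite !inE => /or4P[] /eqP->; rewrite rmem_frame.
  - by rewrite output_frame.
pose I i s1 := (nmem s1 nCand 0 = 0%N /\ forall x : 'I_n, (x < i)%N -> x \notin S) \/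
   exists z : 'I_n, [/\ z \in S, nmem s1 nCand 0 = z.+1, rmem s1 rLow 0 = chain_sum S z
     & forall x : 'I_n, (x < i)%N -> x \in S -> chain_sum S z <= chain_sum S x].
suff : I n s'.
  case=> [[c0 H]|[z [zS cz lz H]]]; [left|right].
    by split=> //; apply/setP => x; rewrite inE; apply: negbTE; exact: H.
  by exists z; split=> // x; exact: H.
rewrite /s' /find_least run_seq.
apply: run_for => //.
  by left.
move=> i s1 iN s1X [An Ar Ao] IH; pose x := Ordinal iN.
have hs1 : represents S B b s1.
  apply: represents_agree hs _ _ _ => [a|a|].
  - by rewrite !inE => /or3P[] /eqP->; rewrite An.
  - by rewrite !inE => /or4P[] /eqP->; rewrite Ar.
  - by rewrite Ao.
have xal : nmem s1 nAlive i = (x \in S) by case: hs1 => _ _ _ [/(_ x)].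
have split_lt (y : 'I_n) : (y < i.+1)%N -> y = x \/ (y < i)%N.
  by rewrite ltnS leq_eqVlt => /orP[/eqP yi|]; [left; apply: val_inj | right].
rewrite run_if [beval _ _ _]/= s1X xal lt0b; case: ifPn => xS; last first.
  case: IH => [[c0 H]|[z [zS cz lz H]]]; [left|right].
    by split=> // y /split_lt[->//|]; exact: H.
  by exists z; split=> // y /split_lt[->|]; [rewrite (negbTE xS) | exact: H].
rewrite !run_seq.
set s2 := tick 1 (run _ _ _).
have hs2 : represents S B b s2 by exact: hs1.
have acc := run_chain_sum hs2 iN s1X erefl.
set s3 := run inp (For _ _ _) _ in acc *.
have s3c : nmem s3 nCand 0 = nmem s1 nCand 0 by rewrite nmem_frame.
have s3X : nmem s3 nX 0 = i by rewrite nmem_frame.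
have s3l : rmem s3 rLow 0 = rmem s1 rLow 0 by rewrite rmem_frame.
right.
rewrite run_if [beval _ _ _]/= acc s3c s3l; case: ifPn.
  rewrite negb_and negbK => upd_; exists x.
  rewrite /= /upd /= s3X addn1; split=> //.
  move=> y /split_lt[->//|yi yS].
  case: IH => [[c0 H]|[z [zS cz lz H]]].
    by have := H _ yi; rewrite yS.
  move: upd_; rewrite cz lz /= => /le_trans; apply; exact: H.
rewrite negbK => /andP[c1 low].
case: IH => [[c0 H]|[z [zS cz lz H]]].
  by move: c1; rewrite c0.
exists z; split=> //; rewrite ?s3l ?s3c //.
move=> y /split_lt[->|]; last exact: H.
by rewrite ltW // -lz ltNge.
Qed.

Lemma run_remove_least S B b s : represents S B b s ->
  let s' := run inp remove_least s in
  (S = finset.set0 /\ represents S B b s') \/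
  exists z : 'I_n, [/\ z \in S,
    forall x : 'I_n, x \in S -> chain_sum S z <= chain_sum S x
  & if b <= chain_sum S z then represents (S :\ z)%SET S (chain_sum S z) s'
    else represents (S :\ z)%SET B b s'].
Proof.
move=> hs s'; rewrite {}/s' /remove_least run_seq.
have [] := @run_find_least S B b (tick 1 s) hs.
set s1 := run inp find_least _ => hs1 [[S0 c0]|[z [zS cz lz zmin]]].
  by left; split=> //=; rewrite c0.
right; exists z; split=> //.
rewrite run_if [beval _ _ _]/= cz [(1 <= _)%N]/=.
rewrite run_seq; set s2 := run inp keep_if_best _.
have s2c : nmem s2 nCand 0 = z.+1 by rewrite nmem_frame.
have hs2 : if b <= chain_sum S z then represents S S (chain_sum S z) s2
           else represents S B b s2.
  case: (hs1) => h1 h2 h3 h4 [h5 h6].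
  rewrite /s2 /keep_if_best run_if [beval _ _ _]/= h6 lz; case: (b <= _) => //.
  rewrite run_seq; set s3 := run inp (set_scalar _ _) _; set s4 := run inp _ s3.
  have s3al (x : 'I_n) : nmem s3 nAlive x = (x \in S) by case: h4 => /(_ x).
  split.
  - by move=> x; rewrite /s4 nmem_frame //; exact: h1.
  - by rewrite /s4 output_frame.
  - by move=> x y; rewrite /s4 rmem_frame //; exact: h3.
  - case: h4 => k1 k2 k3; split.
    + by move=> x; rewrite /s4 nmem_frame //; exact: k1.
    + by move=> x y; rewrite /s4 rmem_frame //; exact: k2.
    + by rewrite /s4 rmem_frame.
  split; last by rewrite /s4 rmem_frame //= /upd /= lz.
  suff H : forall x : 'I_n, (x < n)%N -> nmem s4 nKept x = (x \in S).
    by move=> x; rewrite H.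
  apply: (@run_for _ inp (fun i s' =>
    forall x : 'I_n, (x < i)%N -> nmem s' nKept x = (x \in S))) => //.
  move=> i s5 iN s5X [An _ _] IH x; rewrite /= /upd /= s5X An //.
  by rewrite ltnS leq_eqVlt; case: eqVneq => [<- _|_ /=]; [exact: s3al | exact: IH].
have ez s' : agree_outside (move_point false (NSub (NCell nCand (NLit 0)) (NLit 1))) s2 s' ->
    neval inp s' (NSub (NCell nCand (NLit 0)) (NLit 1)) = z.
  by case=> An _ _; rewrite /= An // s2c subn1.
by case: (b <= _) hs2 => hs2; exact: (@represents_move_point false _ _ _ _ z _ hs2 zS ez).
Qed.

Lemma run_emit_kept S B b s : represents S B b s -> forall z : 'I_n,
  ((z : nat) \in output (run inp emit_kept s)) = (z \in B).
Proof.
case=> _ h2 _ _ [h5 _] z.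
have : forall z : 'I_n,
    ((z : nat) \in output (run inp emit_kept s)) = (z \in B) && (z < n)%N.
  apply: (@run_for _ inp (fun i s' => forall z : 'I_n,
    ((z : nat) \in output s') = (z \in B) && (z < i)%N)) => //.
    by move=> z'; rewrite /= h2 ltn0 andbF.
  move=> i s' iN s'X [An _ _] IH z'.
  have := h5 (Ordinal iN); rewrite -An //= => kept.
  rewrite s'X kept lt0b ltnS leq_eqVlt; case: ifPn => iB /=; last first.
    rewrite IH; case: eqVneq => //= zi.
    have -> : z' = Ordinal iN by exact: val_inj.
    by rewrite ltnn andbF (negbTE iB).
  rewrite inE IH; case: eqVneq => //= zi; rewrite andbT.
  by have -> : z' = Ordinal iN by exact: val_inj.
by move=> ->; rewrite ltn_ord andbT.
Qed.

(** Ties in the choice of z are resolved by the order in which labels are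
scanned.  Quantifying over invariants avoids naming the resulting sequence of
sets: any property kept by deleting an arbitrary minimizer holds at the end.
Rounds that start from the empty set do nothing. *)
Theorem greedy_program_sound (Inv : nat -> {set 'I_n} -> {set 'I_n} -> R -> Prop) :
  Inv 0%N support support 0 ->
  (forall k B b, Inv k finset.set0 B b -> Inv k.+1 finset.set0 B b) ->
  (forall k S B b (z : 'I_n), Inv k S B b -> z \in S ->
     (forall x : 'I_n, x \in S -> chain_sum S z <= chain_sum S x) ->
     if b <= chain_sum S z then Inv k.+1 (S :\ z)%SET S (chain_sum S z)
     else Inv k.+1 (S :\ z)%SET B b) ->
  exists S B b, Inv n S B b /\ forall z : 'I_n,
    ((z : nat) \in output (run inp greedy_program (init (R := R)))) = (z \in B).
Proof.
move=> Inv0 Inv_empty Inv_step.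
rewrite /greedy_program !run_seq.
set s1 := run inp set_rows _; set s2 := run inp (for_pairs set_gap) _.
set s3 := run inp insert_support _; set s4 := run inp (For nRound _ _) _.
have rows1 : rows_ok s1 by exact: run_set_rows.
have gap2 : forall x y : nat, (x < n)%N -> (y < n)%N ->
    rmem s2 rGap (x * n + y)%N = next_dist x y - d x y.
  apply: (@run_for_pairs set_gap rGap (fun x y _ => next_dist x y - d x y)) => //.
  move=> s' x y xn yn [An _ _] s'X s'Y k; apply: run_set_gap => //.
  by rewrite An //; apply: rows1; exact: ltnW.
have s2n : {in [:: nAlive; nKept], forall b, nmem s2 b = fun=> 0%N}.
  by move=> b; rewrite !inE => /orP[] /eqP->; rewrite /s2 nmem_frame // /s1 nmem_frame.
have s2r : {in [:: rBall; rBest; rTot], forall b, rmem s2 b = fun=> 0}.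
  by move=> b; rewrite !inE => /or3P[] /eqP->; rewrite /s2 rmem_frame // /s1 rmem_frame.
have hs2 : represents finset.set0 finset.set0 0 s2.
  split=> //.
  - by move=> x; rewrite /s2 nmem_frame //; exact: rows1.
  - by rewrite /s2 output_frame // /s1 output_frame.
  - split=> [z|x y _ _|]; rewrite ?s2n ?s2r ?inE //.
      by rewrite /ball_mass big_mkcondr big_set0.
    by rewrite /total_mass big_set0.
  - by split=> [z|]; rewrite ?s2n ?s2r ?inE.
have hs3 : represents support support 0 s3 by exact: run_insert_support.
have [S [B [b [hI hs4]]]] : exists S B b, Inv n S B b /\ represents S B b s4.
  apply: (@run_for _ inp (fun k s' => exists S B b, Inv k S B b /\ represents S B b s')) => //.
    by exists support, support, 0.
  move=> k s' kN _ _ [S [B [b [hI hs]]]].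
  have [[S0 hs']|[z [zS zmin hs']]] := run_remove_least hs.
    by exists S, B, b; split=> //; move: hI; rewrite S0; exact: Inv_empty.
  have := Inv_step _ _ _ _ _ hI zS zmin; case: (b <= _) hs' => hs' hI'.
    by exists (S :\ z)%SET, S, (chain_sum S z).
  by exists (S :\ z)%SET, B, b.
by exists S, B, b; split=> //; exact: run_emit_kept hs4.
Qed.

End Correctness.
End Program.

(** * The chaining inequality for the greedy set *)

Section NextDist.
Context {R : realType}.
Variables (inp : input R) (x : nat).
Local Notation n := (in_size inp).
Local Notation d := (in_dist inp).
Hypothesis d_ge0 : forall z, (z < n)%N -> 0 <= d x z.

Let far : R := \sum_(0 <= z < n) d x z.
Let upto (y i : nat) : R := iteri i (fun z v =>
  if later_label inp x y z && (d x z <= v) then d x z else v) far.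

Let le_far z : (z < n)%N -> d x z <= far.
Proof.
move=> zn; rewrite /far big_mkord (bigD1 (Ordinal zn)) //= lerDl.
by apply: sumr_ge0 => i _; exact: d_ge0.
Qed.

Lemma next_dist_ge y : (y < n)%N -> d x y <= next_dist inp x y.
Proof.
move=> yn; suff : forall i, d x y <= upto y i by exact.
elim=> [|i IH]; first exact: le_far.
by rewrite /upto iteriS; case: ifP => // /andP[/andP[]].
Qed.

Lemma next_dist_le y z : (z < n)%N -> later_label inp x y z ->
  next_dist inp x y <= d x z.
Proof.
move=> zn yz; suff : forall i, (z < i)%N -> upto y i <= d x z by exact.
elim=> [//|i IH]; rewrite ltnS leq_eqVlt /upto iteriS -/(upto y i).
move=> /orP[/eqP <-|/IH {}IH]; first by case: ifP => // /negbT; rewrite yz -ltNge => /ltW.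
by case: ifP => // /andP[_ h]; exact: le_trans h IH.
Qed.

(** The search returns its initial value only if that value is attained: it is an
upper bound of the distances from x, and the result is at most the later
distance d(x, z). *)
Lemma next_dist_eq y z : (z < n)%N -> later_label inp x y z ->
  exists k, [/\ (k < n)%N, later_label inp x y k & next_dist inp x y = d x k].
Proof.
move=> zn yz.
have [E|//] : next_dist inp x y = far \/
    exists k, [/\ (k < n)%N, later_label inp x y k & next_dist inp x y = d x k].
  suff : forall i, (i <= n)%N -> upto y i = far \/
    exists k, [/\ (k < n)%N, later_label inp x y k & upto y i = d x k] by exact.
  elim=> [|i IH] iN; first by left.
  rewrite /upto iteriS -/(upto y i); case: ifP => [/andP[yi _]|_]; last exact/IH/ltnW.
  by right; exists i.
exists z; split=> //; apply/eqP; rewrite eq_le next_dist_le //= E; exact: le_far.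
Qed.

End NextDist.

Section Main.
Context {R : realType} {X : finMetricType R} {n : nat}.
Variables (e : 'I_n -> X) (f h : R -> R) (nu : X -> R).
Hypothesis e_bij : bijective e.
Hypothesis fd : monotone_density f.
Hypothesis fh : chaining_functional f h.
Hypothesis fl : log_concave f.
Hypothesis hl : exists l : R, left_derivative h 1 l /\ `|l| = 1.
Hypothesis nu_prob : is_prob nu.

Local Notation mu := (@lebesgue_measure R).
Local Notation inp := (problem_input e nu h).
Local Notation supp := (support inp : {set 'I_n}).
Local Notation tot := (total_mass (inp := inp)).
Local Notation val := (chain_sum (inp := inp)).
Implicit Types (S A : {set 'I_n}) (i j z : 'I_n).

Let e_inj : injective e := bij_inj e_bij.

Lemma in_distE i j : in_dist inp i j = mdist (e i) (e j).
Proof. by rewrite /= !valK. Qed.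

Lemma in_massE i : in_mass inp i = nu (e i).
Proof. by rewrite /= valK. Qed.

Lemma in_suppE i : (i \in supp) = (0 < nu (e i)).
Proof. by rewrite inE in_massE. Qed.

Lemma meas_imset A : meas nu (e @: A)%SET = \sum_(i in A) nu (e i).
Proof. by rewrite /meas big_imset //= => i j _ _; exact: e_inj. Qed.

Lemma tot_meas S : tot S = meas nu (e @: S)%SET.
Proof. by rewrite meas_imset; apply: eq_bigr => i _; rewrite in_massE. Qed.

Lemma cball_level i r : cball (e i) r = (e @: level (fun j => mdist (e i) (e j)) r)%SET.
Proof.
have [e' eK e'K] := e_bij.
apply/setP => x; rewrite inE; apply/idP/imsetP => [xr|[j jr ->]].
  by exists (e' x); rewrite ?inE e'K.
by move: jr; rewrite inE.
Qed.

Lemma cond_imset S A : cond nu (e @: S)%SET (e @: A)%SET =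
  (\sum_(z in A :&: S) nu (e z)) / tot S.
Proof.
rewrite /cond tot_meas -meas_imset imsetI // => x y _ _; exact: e_inj.
Qed.

Let nu_ge0 x : 0 <= nu x.
Proof. by case: nu_prob. Qed.

(** Points outside the support have mass 0, so conditioning on the support
changes nothing; this makes nu itself one of the measures nu_S. *)
Lemma tot_supp : tot supp = 1.
Proof.
case: nu_prob => _ <-; rewrite /total_mass (reindex e) /=; last first.
  exact: onW_bij.
rewrite [RHS](bigID (fun i => i \in supp)) /= [X in _ + X]big1 ?addr0.
  by apply: eq_bigr => i _; rewrite valK.
move=> i; rewrite in_suppE -leNgt => ei.
by apply/eqP; rewrite eq_le ei nu_ge0.
Qed.

Lemma cond_supp A : cond nu (e @: supp)%SET (e @: A)%SET = meas nu (e @: A)%SET.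
Proof.
rewrite cond_imset tot_supp divr1 meas_imset.
rewrite [RHS](bigID (fun i => i \in supp)) /= [X in _ + X]big1 ?addr0.
  by apply: eq_bigl => i; rewrite inE.
move=> i /andP[_]; rewrite in_suppE -leNgt => ei.
by apply/eqP; rewrite eq_le ei nu_ge0.
Qed.

Lemma tot_gt0 S i : i \in S -> S \subset supp -> 0 < tot S.
Proof.
move=> iS /fintype.subsetP Ssupp; rewrite /total_mass (bigD1 i) //= valK.
by rewrite ltr_pwDl ?sumr_ge0 // -?in_suppE ?Ssupp // => j _; rewrite valK.
Qed.

Lemma le_tot S (T : {set 'I_n}) : S \subset T -> tot S <= tot T.
Proof.
move=> ST; rewrite !tot_meas !meas_imset [leRHS](big_setID S) /=.
by rewrite (finset.setIidPr ST) lerDl; apply: sumr_ge0 => i _.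
Qed.

(** For x in S, every ball around x has positive nu_S-mass.  This keeps all
arguments of h in ]0, 1], the only place where h is specified. *)
Section Point.
Variables (S : {set 'I_n}) (i : 'I_n).
Hypotheses (iS : i \in S) (Ssupp : S \subset supp).
Let dd j := mdist (e i) (e j).
Let phi A := h (cond nu (e @: S)%SET (e @: A)%SET).

Lemma cond_gt0 A : i \in A -> 0 < cond nu (e @: S)%SET (e @: A)%SET.
Proof.
move=> iA; rewrite cond_imset divr_gt0 ?(tot_gt0 iS) //.
rewrite (bigD1 i) ?inE ?iA //= ltr_pwDl ?sumr_ge0 // -in_suppE.
exact: (fintype.subsetP Ssupp).
Qed.

Lemma cond_le1 A : cond nu (e @: S)%SET (e @: A)%SET <= 1.
Proof.
rewrite cond_imset ler_pdivrMr ?(tot_gt0 iS) // mul1r tot_meas meas_imset.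
rewrite [leRHS](big_setID A) /= finset.setIC lerDl.
by apply: sumr_ge0.
Qed.

Let phiT : phi [set: 'I_n]%SET = 0.
Proof.
rewrite /phi cond_imset finset.setTI.
rewrite -meas_imset -tot_meas divff ?(chaining1 fd fh) //.
by rewrite gt_eqF // (tot_gt0 iS).
Qed.

Let i_level (r : R) : 0 <= r -> i \in level dd r.
Proof. by move=> r0; rewrite inE /dd mdistxx. Qed.

Let phi_ge0 (r : R) : 0 <= r -> 0 <= phi (level dd r).
Proof.
move=> r0; apply: (chaining_ge0 fd fh); last exact: cond_le1.
by apply: cond_gt0; exact: i_level.
Qed.

Let nxt (j : 'I_n) := next_dist inp i j.
Let dE : dd = fun j : 'I_n => in_dist inp i j.
Proof. by apply/funext => j; rewrite in_distE. Qed.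

Let d_ge0 (z : nat) : (z < in_size inp)%N -> 0 <= in_dist inp i z.
Proof. by move=> zn; rewrite (in_distE i (Ordinal zn)) mdist_ge0. Qed.

Let dd_ge0 j : 0 <= dd j. Proof. exact: mdist_ge0. Qed.
Let dd_eq0 : exists j, dd j = 0. Proof. by exists i; rewrite /dd mdistxx. Qed.
Let nxt_ge j : dd j <= nxt j.
Proof. by rewrite dE; exact: next_dist_ge. Qed.
Let nxt_le j k : later dd j k -> nxt j <= dd k.
Proof. by rewrite dE => jk; apply: next_dist_le. Qed.
Let nxt_eq j k : later dd j k -> exists2 k', later dd j k' & nxt j = dd k'.
Proof.
rewrite dE => jk; have [k' [k'n jk' E]] := next_dist_eq d_ge0 (ltn_ord k) jk.
by exists (Ordinal k'n).
Qed.

Lemma measurable_chain_int :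
  measurable_fun (`[0, +oo[%classic : set R)
    (fun r => (h (cond nu (e @: S)%SET (cball (e i) r)))%:E).
Proof.
rewrite (_ : (fun r => _) = (fun r => (phi (level dd r))%:E)); last first.
  by apply/funext => r; rewrite cball_level.
exact: (measurable_level dd_eq0 nxt_le nxt_eq phiT).
Qed.

Lemma chain_int_ge0 (r : R) : 0 <= r -> 0 <= h (cond nu (e @: S)%SET (cball (e i) r)).
Proof. by move=> r0; rewrite cball_level; exact: phi_ge0. Qed.

Lemma chain_intE : chain_int h (cond nu (e @: S)%SET) (e i) = (val S i)%:E.
Proof.
rewrite /chain_int; under eq_integral do rewrite cball_level.
rewrite (integral_level dd_ge0 dd_eq0 nxt_ge nxt_le nxt_eq phiT phi_ge0).
congr _%:E; rewrite /chain_sum big_mkord; apply: eq_bigr => j _.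
rewrite in_distE /phi cond_imset; congr (h (_ / _) * _).
apply: eq_big => [z|z _]; last by rewrite in_massE.
by rewrite !inE !in_distE andbC.
Qed.

Lemma chain_sum_ge0 : 0 <= val S i.
Proof.
rewrite -lee_fin -chain_intE; apply: integral_ge0 => r; rewrite /= in_itv /= andbT => r0.
by rewrite lee_fin chain_int_ge0.
Qed.

End Point.

Lemma mdist_le_diam (x y : X) : mdist x y <= diam (X := X).
Proof.
by apply: (bigmax_sup x) => //; exact: (bigmax_sup y).
Qed.

Lemma meas_cball_supp i (r : R) :
  meas nu (cball (e i) r) = cond nu (e @: supp)%SET (cball (e i) r).
Proof. by rewrite cball_level cond_supp. Qed.

Lemma chain_int_measE i : i \in supp -> chain_int h (meas nu) (e i) = (val supp i)%:E.
Proof.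
move=> isupp; rewrite -(chain_intE isupp) //; apply: eq_integral => r _.
by rewrite meas_cball_supp.
Qed.

Lemma tot_cond_le_meas S i (r : R) : i \in S -> S \subset supp ->
  tot S * cond nu (e @: S)%SET (cball (e i) r) <= meas nu (cball (e i) r).
Proof.
move=> iS Ssupp; rewrite cball_level cond_imset mulrC divfK; last first.
  by rewrite gt_eqF // (tot_gt0 iS).
by rewrite meas_imset [leRHS](big_setID S) /= lerDl; apply: sumr_ge0.
Qed.

(** Below the diameter, subadditivity of h bounds the excess of the integrand for
nu over the integrand for nu_S by the constant h(nu(S)).  Above the diameter the
balls are everything and the integrand for nu is 0. *)
Lemma chain_sum_supp_le S i : i \in S -> S \subset supp ->
  val supp i <= val S i + diam (X := X) * h (tot S).
Proof.
move=> iS Ssupp; have isupp := fintype.subsetP Ssupp _ iS.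
have t0 : 0 < tot S by exact: tot_gt0 iS Ssupp.
have t1 : tot S <= 1 by rewrite -tot_supp le_tot.
have ht0 : 0 <= h (tot S) by exact: chaining_ge0 fd fh _ t0 t1.
have D0 : 0 <= diam (X := X) by rewrite (le_trans _ (mdist_le_diam (e i) (e i))) ?mdist_ge0.
rewrite -lee_fin EFinD -!chain_intE // /chain_int.
have -> : (diam (X := X) * h (tot S))%:E =
  (\int[mu]_(r in `[0%R, +oo[) ((h (tot S))%:E * (\1_(`[0%R, diam (X := X)]%classic) r)%:E))%E.
  rewrite ge0_integralZl_EFin //=; last first.
    by apply/measurable_EFinP; exact: measurable_indic.
  rewrite integral_indic //.
  rewrite (_ : _ `&` _ = `[0, diam (X := X)]%classic); last first.
    by apply/setIidl => r /=; rewrite !in_itv /= andbT => /andP[].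
  rewrite mulrC EFinM; congr (_ * _)%E.
  rewrite [RHS]lebesgue_measure_itv /= lte_fin sube0; case: ltP => // D0'.
  by have -> : diam (X := X) = 0 by apply/eqP; rewrite eq_le D0' D0.
have mind : measurable_fun (`[0, +oo[%classic : set R)
    (fun r => ((h (tot S))%:E * (\1_(`[0%R, diam (X := X)]%classic) r)%:E)%E).
  apply: emeasurable_funM; first exact: measurable_cst.
  by apply/measurable_EFinP; exact: measurable_indic.
rewrite -ge0_integralD //=; first last.
- by move=> r _; rewrite mule_ge0 // lee_fin.
- exact: measurable_chain_int.
- by move=> r; rewrite /= in_itv /= andbT lee_fin => r0; exact: chain_int_ge0.
apply: ge0_le_integral => //=.
- by move=> r; rewrite /= in_itv /= andbT lee_fin => r0; exact: chain_int_ge0.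
- exact: measurable_chain_int.
- by apply: emeasurable_funD => //; exact: measurable_chain_int.
move=> r; rewrite /= in_itv /= andbT => r0.
rewrite -EFinM -EFinD lee_fin -meas_cball_supp indicE.
have p0 : 0 < cond nu (e @: S)%SET (cball (e i) r).
  by rewrite cball_level (cond_gt0 iS Ssupp) // inE mdistxx.
have p1 : cond nu (e @: S)%SET (cball (e i) r) <= 1.
  by rewrite cball_level (cond_le1 iS Ssupp).
have [rD|rD] := leP r (diam (X := X)).
  rewrite mem_set ?mulr1 /= ?in_itv /= ?r0 // addrC.
  apply: le_trans (chaining_submul fd fh fl t0 t1 p0 p1).
  apply: (chaining_anti fd fh); [exact: mulr_gt0 | exact: tot_cond_le_meas |].
  by rewrite meas_cball_supp cball_level (cond_le1 isupp).
have -> : meas nu (cball (e i) r) = 1.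
  case: nu_prob => _ <-; apply: eq_bigl => x; rewrite inE.
  by rewrite (le_trans (mdist_le_diam _ _)) // ltW.
by rewrite (chaining1 fd fh) addr_ge0 ?mulr_ge0 // chain_int_ge0.
Qed.

(** The last clause is the bound to be proved, restricted to the points deleted so
far.  Once S is empty it reads as the full bound, since ln 0 has weight 0.  The
first clause also records that n rounds suffice to empty S. *)
Definition greedy_inv (k : nat) (S B : {set 'I_n}) (b : R) : Prop :=
  [/\ S \subset supp /\ (S = finset.set0 \/ (#|S| + k <= n)%N),
      B \subset supp, B != finset.set0,
      forall i, i \in B -> b <= val B i
    & \sum_(i in supp :\: S) nu (e i) * val supp i <=
      (1 - tot S) * b + diam (X := X) * (1 - (tot S - tot S * ln (tot S)))].

Lemma greedy_inv0 : greedy_inv 0 supp supp 0.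
Proof.
split=> //.
- by split=> //; right; rewrite addn0 -[leqRHS]card_ord max_card.
- apply/eqP => s0; have := tot_supp; rewrite s0 /total_mass big_set0.
  by move/eqP; rewrite eq_sym oner_eq0.
- by move=> i isupp; exact: chain_sum_ge0.
rewrite tot_supp ln1 !mulr0 subr0 subrr mulr0 addr0.
by rewrite finset.setDv big_set0.
Qed.

Lemma greedy_inv_step k S B b z : greedy_inv k S B b -> z \in S ->
  (forall i, i \in S -> val S z <= val S i) ->
  if b <= val S z then greedy_inv k.+1 (S :\ z)%SET S (val S z)
  else greedy_inv k.+1 (S :\ z)%SET B b.
Proof.
case=> -[Ssupp cardS] Bsupp B0 Bmin Hsum zS zmin.
have zsupp := fintype.subsetP Ssupp _ zS.
have S0 : S != finset.set0 by apply/set0Pn; exists z.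
have S'supp : (S :\ z)%SET \subset supp := fintype.subset_trans (subD1set _ _) Ssupp.
have cardS' : (S :\ z)%SET = finset.set0 \/ (#|(S :\ z)%SET| + k.+1 <= n)%N.
  right; case: cardS => [E|]; first by rewrite E eqxx in S0.
  by rewrite (cardsD1 z S) zS addnS.
have t0 : 0 < tot S by exact: tot_gt0 zS Ssupp.
have t1 : tot S <= 1 by rewrite -tot_supp le_tot.
have tD : tot S = nu (e z) + tot (S :\ z)%SET.
  by rewrite !tot_meas !meas_imset (big_setD1 z).
have t'0 : 0 <= tot (S :\ z)%SET.
  by rewrite tot_meas meas_imset; apply: sumr_ge0.
have t't : tot (S :\ z)%SET <= tot S by rewrite le_tot // subD1set.
have D0 : 0 <= diam (X := X) by rewrite (le_trans _ (mdist_le_diam (e z) (e z))) ?mdist_ge0.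
(* The best minimum after this round, whichever set is kept. *)
pose b' := Num.max b (val S z).
have sumD : \sum_(i in supp :\: (S :\ z)) nu (e i) * val supp i =
    nu (e z) * val supp z + \sum_(i in supp :\: S) nu (e i) * val supp i.
  rewrite (big_setD1 z) /=; last by rewrite finset.in_setD zsupp in_setD1 eqxx.
  congr (_ + _); apply: eq_bigl => i; rewrite !inE.
  by case: eqVneq => [->|] //=; rewrite zS.
have Hsum' : \sum_(i in supp :\: (S :\ z)) nu (e i) * val supp i <=
    (1 - tot (S :\ z)%SET) * b' +
    diam (X := X) * (1 - (tot (S :\ z)%SET - tot (S :\ z)%SET * ln (tot (S :\ z)%SET))).
  have hz : val supp z <= b' + diam (X := X) * - ln (tot S).
    apply: le_trans (chain_sum_supp_le zS Ssupp) _.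
    rewrite lerD ?le_max ?lexx ?orbT // ler_wpM2l //.
    exact: chaining_le_ln fd fh fl hl _ t0 t1.
  have bb' : b <= b' by rewrite le_max lexx.
  have h1 : nu (e z) * val supp z <= nu (e z) * (b' + diam (X := X) * - ln (tot S)).
    by rewrite ler_wpM2l.
  have h2 : (1 - tot S) * b <= (1 - tot S) * b' by rewrite ler_wpM2l // subr_ge0.
  have h3 := ler_wpM2l D0 (entropy_step t'0 t't t0).
  rewrite sumD; have -> : nu (e z) = tot S - tot (S :\ z)%SET by lra.
  have {}h1 : (tot S - tot (S :\ z)%SET) * val supp z <=
      (tot S - tot (S :\ z)%SET) * (b' + diam (X := X) * - ln (tot S)).
    by have -> : tot S - tot (S :\ z)%SET = nu (e z) by lra.
  by move: h1 h2 h3 Hsum; lra.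
rewrite /b' in Hsum'; move: Hsum'; case: (leP b (val S z)) => bz Hsum'; by split.
Qed.

Lemma greedy_inv_empty k B b :
  greedy_inv k finset.set0 B b -> greedy_inv k.+1 finset.set0 B b.
Proof. by case=> -[h1 h2] h3 h4 h5 h6; split=> //; split=> //; left. Qed.

Lemma greedy_inv_end S B b : greedy_inv n S B b ->
  (\sum_(x : X) (nu x)%:E * chain_int h (meas nu) x
     <= \big[Order.min/+oo]_(x in (e @: B)%SET) chain_int h (cond nu (e @: B)%SET) x
        + (diam (X := X))%:E)%E.
Proof.
case=> -[_ cardS] Bsupp B0 Bmin Hsum.
have S0 : S = finset.set0.
  case: cardS => // cS; apply/eqP; rewrite -cards_eq0.
  by move: cS; rewrite -[X in (_ <= X)%N]add0n leq_add2r leqn0.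
have lhs : (\sum_(x : X) (nu x)%:E * chain_int h (meas nu) x)%E =
    (\sum_(i in supp) nu (e i) * val supp i)%:E.
  rewrite (reindex e) /=; last exact: onW_bij.
  rewrite (bigID (fun i => i \in supp)) /= [X in (_ + X)%E]big1 ?adde0.
    rewrite -sumEFin; apply: eq_bigr => i isupp.
    by rewrite chain_int_measE // EFinM.
  move=> i; rewrite in_suppE -leNgt => ei.
  by have -> : nu (e i) = 0; [apply/eqP; rewrite eq_le ei nu_ge0 | rewrite mul0e].
rewrite lhs; apply: (@le_trans _ _ (b + diam (X := X))%:E).
  move: Hsum; rewrite S0 finset.setD0 /total_mass big_set0 mul0r !subr0 !mul1r mulr1.
  by rewrite lee_fin.
rewrite EFinD leeD2r //; apply/bigmin_geP; split=> [|x /imsetP[i iB ->]]; first exact: leey.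
by rewrite chain_intE // lee_fin Bmin.
Qed.

End Main.

Theorem lemma1p6 (R : realType) :
  exists (P : cmd) (C : nat),
  forall (n : nat) (X : finMetricType R) (e : 'I_n -> X) (f h : R -> R)
    (nu : X -> R),
    bijective e ->
    monotone_density f -> chaining_functional f h -> log_concave f ->
    (exists l : R, left_derivative h 1 l /\ `|l| = 1) ->
    is_prob nu ->
    exists S : {set X},
      [/\ S != finset.set0,
          S \subset [set x : X | 0 < nu x]%SET,
          (\sum_(x : X) (nu x)%:E * chain_int h (meas nu) x
             <= \big[Order.min/+oo]_(x in S) chain_int h (cond nu S) x
                + (diam (X := X))%:E)%E
        & computes P e nu h S (C * n ^ 3)].
Proof.
exists greedy_program, (cost_bound 1 greedy_program).
move=> n X e f h nu e_bij fd fh fl hl nu_prob.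
have [S [B [b [hI out]]]] := greedy_program_sound (greedy_inv0 e_bij fd fh nu_prob)
  (@greedy_inv_empty _ _ _ e h nu) (greedy_inv_step e_bij fd fh fl hl nu_prob).
have [_ Bsupp B0 _ _] := hI.
exists (e @: B)%SET; split.
- by rewrite imset_eq0.
- apply/fintype.subsetP => x /imsetP[i iB ->]; rewrite inE -(in_suppE e h nu).
  exact: fintype.subsetP Bsupp _ iB.
- by have := greedy_inv_end e_bij fd fh nu_prob hI.
split.
  apply/setP => x; apply/imsetP/imsetP => -[i iB ->]; exists i => //.
    by rewrite -out; move: iB; rewrite inE.
  by rewrite inE; move: iB; rewrite -out.
apply: greedy_program_cost => /=.
have /set0Pn[i _] := B0.
exact: leq_ltn_trans (leq0n i) (ltn_ord i).
Qed.
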